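(* Consider a jump process on a measurable space $S$ with generator $$Lf(x)=\int(f(y)-f(x))\,q(x,dy)$$ and an invariant probability measure $\mu$. Assume the jump rates are bounded: $q(x,S)\le q_{\max}<\infty$ for $\mu$-a.e. $x$. Let $\gamma:=\inf_{f\in L^2_0(\mu)\setminus\{0\}}\|Lf\|/\|f\|$ be the singular-value gap of $L$ on $L^2_0(\mu)$, and let $\gamma_s$ be the spectral gap of the symmetrized generator $L_s=\frac{L+L^*}{2}$, which is a bounded self-adjoint operator on $L^2(\mu)$. Then $$\gamma\le\sqrt{2q_{\max}\gamma_s}.$$
   Context: The jump kernel $q(x,dy)$ is such that $q(x,\cdot)$ is a finite measure on $S$ for each $x$ and $x\mapsto q(x,A)$ is measurable for each measurable $A$; $q(x,S)$ is the jump rate at $x$. $L^2(\mu)$ is the space of complex-valued square-integrable functions with $\langle f,g\rangle=\int\bar f g\,d\mu$ and norm $\|\cdot\|$; $L^2_0(\mu)=\{g\in L^2(\mu):\int g\,d\mu=0\}$. Invariance of $\mu$ means $\int Lh\,d\mu=0$ for every bounded measurable $h$. With bounded rates, $L$ is a bounded operator on $L^2(\mu)$, and $L^*$ is its adjoint. The spectral gap of $L_s$ is $\gamma_s=\inf\sigma(-L_s|_{L^2_0(\mu)})=\inf_{f\in L^2_0(\mu),\,\|f\|=1}\langle f,-L_sf\rangle$. *)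

(* Defs.v *)
(* MathComp-Analysis, with the complex numbers R[i] of real-closed. *)
From HB Require Import structures.
From mathcomp Require Export all_boot all_order all_algebra.
From mathcomp Require Export all_classical all_reals all_analysis.
From mathcomp Require Export complex.

Set Implicit Arguments.
Unset Strict Implicit.
Unset Printing Implicit Defensive.

Import Order.TTheory GRing.Theory Num.Theory.
Import numFieldNormedType.Exports.
Import ComplexField.

Local Open Scope classical_set_scope.
Local Open Scope ring_scope.

Section ComplexL2.
Context {d : measure_display} {T : measurableType d} {R : realType}.
Implicit Types (m : {measure set T -> \bar R}) (f g h : T -> R[i]).
Implicit Types (V : set (T -> R[i])) (A B : (T -> R[i]) -> T -> R[i]).

Definition cmeasurable f : Prop :=
  measurable_fun [set: T] (fun x => complex.Re (f x)) /\
  measurable_fun [set: T] (fun x => complex.Im (f x)).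

(* Meaningful when f is m-integrable; a part with no finite integral
   contributes 0, by the convention of Rintegral. *)
Definition cintegral m f : R[i] :=
  Complex (Rintegral m [set: T] (fun x => complex.Re (f x)))
          (Rintegral m [set: T] (fun x => complex.Im (f x))).

(* L^2(m) is handled through representatives: its elements are functions, and
   equality in L^2(m) is equality m-almost everywhere. *)
Definition L2 m : set (T -> R[i]) :=
  [set f | cmeasurable f /\ finite_norm m 2%:E (fun x => Normc.normc (f x))].

Definition L2_0 m : set (T -> R[i]) :=
  [set f | L2 m f /\ cintegral m f = 0].

Definition L2norm m f : R :=
  fine (Lnorm m 2%:E (fun x => (Normc.normc (f x))%:E)).

Definition inner m f g : R[i] :=
  cintegral m (fun x => conjc (f x) * g x).

(* A bounded operator on the subspace V of L^2(m). Compatibility of A with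
   almost everywhere equality follows from the last two clauses. *)
Definition bounded_operator m V A : Prop :=
  [/\ forall f, V f -> V (A f),
      forall (c : R[i]) f g, V f -> V g ->
        A (fun x => c * f x + g x) = (fun x => c * A f x + A g x) %[ae m]
    & exists M : R, forall f, V f -> L2norm m (A f) <= M * L2norm m f].

Definition self_adjoint m A : Prop :=
  forall f g, L2 m f -> L2 m g -> inner m f (A g) = inner m (A f) g.

(* The adjoint on L^2(m): A^* f is a function g in L^2(m) such that
   <g, h> = <f, A h> for all h in L^2(m). It is determined up to almost
   everywhere equality, and exists when A is bounded on L^2(m). *)
Definition adjoint m A : (T -> R[i]) -> T -> R[i] := fun f =>
  xget (cst 0)
    [set g | L2 m g /\ forall h, L2 m h -> inner m g h = inner m f (A h)].

Definition symmetrized m A : (T -> R[i]) -> T -> R[i] := fun f x =>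
  (A f x + adjoint m A f x) / 2%:R.

(* The spectrum of A restricted to an A-invariant subspace V of L^2(m): the z
   such that A - z has no bounded two-sided inverse B on V. *)
Definition spectrum m V A : set R[i] :=
  [set z | ~ exists B, [/\ bounded_operator m V B,
      forall f, V f -> B (fun x => A f x - z * f x) = f %[ae m]
    & forall f, V f -> (fun x => A (B f) x - z * B f x) = f %[ae m]]].

(* For a self-adjoint generator A = L_s: inf of the spectrum of - A on
   L^2_0(m), which consists of real numbers. *)
Definition spectral_gap m A : R :=
  inf [set r : R | spectrum m (L2_0 m) (fun f x => - A f x) (r%:C)%C].

Definition singular_value_gap m A : R :=
  inf [set L2norm m (A f) / L2norm m f |
        f in [set f | L2_0 m f /\ ~ (f = cst 0 %[ae m])]].

Definition jump_generator (q : T -> {measure set T -> \bar R}) :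
    (T -> R[i]) -> T -> R[i] := fun f x =>
  cintegral (q x) (fun y => f y - f x).

Definition invariant_measure (q : T -> {measure set T -> \bar R}) m : Prop :=
  forall h, cmeasurable h -> (exists M : R, forall x, Normc.normc (h x) <= M) ->
    cintegral m (jump_generator q h) = 0.

End ComplexL2.

(* Main.v *)
Require Import Defs.
From HB Require Import structures.
From mathcomp Require Import all_boot all_order all_algebra.
From mathcomp Require Import all_classical all_reals all_analysis.
From mathcomp Require Import complex measurable_realfun ring lra.

Set Implicit Arguments.
Unset Strict Implicit.
Unset Printing Implicit Defensive.

Import Order.TTheory GRing.Theory Num.Theory.
Import numFieldNormedType.Exports.

Local Open Scope classical_set_scope.
Local Open Scope ring_scope.

(** The inequality comes from one estimate on the generator. For almost every
    [x], Cauchy-Schwarz for the measure [q x] bounds [|L f x| ^ 2] by [q_max]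
    times the integral of [|f y - f x| ^ 2] over [q x]. Expanding the square,
    the latter is
      [\int |f y| ^ 2 q(x, dy) - q(x, S) |f x| ^ 2 - 2 Re (conj (f x) * L f x)],
    so no double integral is needed (Rintegral_sub_sqr_le). Integrating over
    [mu], the first two terms cancel by invariance, which has to be extended
    from bounded to nonnegative functions (invariance_nonneg); what is left is
      [|| L f || ^ 2 <= 2 q_max Re <f, - L f> = 2 q_max <f, - L_s f>]
    (sqint_real_generator, jump_generator_L2). Hence
    [gamma ^ 2 || f || ^ 2 <= 2 q_max <f, - L_s f>] on mean-zero functions.

    It remains to compare the quadratic form of [- L_s] with its spectrum,
    which is defined by the absence of a bounded inverse. If the quadratic form
    of a symmetric operator [A] is at least [a || f || ^ 2], every real
    [r < a] has [A - r] coercive, hence invertible (coercive_notin_spectrum),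
    so the spectrum lies above [a]. The infimum of an empty spectrum would be 0
    by convention, so the spectrum must also be shown to contain a real number:
    the infimum of the Rayleigh quotient is one (spectrum_nonempty).

    Both the adjoint of [L] and the inverse of a coercive operator are obtained
    from the Riesz representation theorem, proved for an abstract semidefinite
    form by minimization. It is used on L^2 regarded as a real vector space,
    for the real part of the inner product and for the form of a coercive
    operator. Completeness of L^2 (sqint_complete) is proved by the
    Riesz-Fischer argument. *)

(** * Positive semidefinite forms on a real vector space *)

Section PreHilbert.
Variables (R : realType) (V : lmodType R).
Implicit Types (H : set V) (b : V -> V -> R) (f g h : V).

(** The form is only asked to be semidefinite, and only on a subset [H] of the
    ambient space, because square-integrable functions are handled through
    representatives: null vectors are the functions vanishing almost
    everywhere. *)
Record prehilbert H b : Prop := PreHilbert {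
  preh_closed : forall (a : R) f g, H f -> H g -> H (a *: f + g);
  preh_sym : forall f g, H f -> H g -> b f g = b g f;
  preh_linear : forall (a : R) f g h, H f -> H g -> H h ->
    b f (a *: g + h) = a * b f g + b f h;
  preh_ge0 : forall f, H f -> 0 <= b f f }.

Definition cauchy_complete H b : Prop := forall u : nat -> V,
  (forall n, H (u n)) ->
  (forall e, 0 < e -> exists N, forall m n, (N <= m)%N -> (N <= n)%N ->
     b (u m - u n) (u m - u n) < e) ->
  exists2 l, H l &
    forall e, 0 < e -> exists N, forall n, (N <= n)%N ->
      b (u n - l) (u n - l) < e.

Lemma discriminant_le (a B c : R) : 0 <= a ->
  (forall t, 0 <= c + 2 * t * B + t ^+ 2 * a) -> B ^+ 2 <= c * a.
Proof.
move=> a0 ht; have [a00|an0] := eqVneq a 0; last first.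
  have := ht (- (B / a)); rewrite -(@pmulr_lge0 _ a) ?lt_def ?an0//.
  have -> : (c + 2 * - (B / a) * B + (- (B / a)) ^+ 2 * a) * a
      = c * a - B ^+ 2 by field.
  by rewrite subr_ge0.
have [->|B0] := eqVneq B 0; first by rewrite a00; lra.
have := ht (- (c + 1) / (2 * B)); rewrite a00.
have -> : c + 2 * (- (c + 1) / (2 * B)) * B + (- (c + 1) / (2 * B)) ^+ 2 * 0
   = -1 by field.
by rewrite oppr_ge0 ler10.
Qed.

Section Theory.
Variables (H : set V) (b : V -> V -> R).
Hypothesis Hb : prehilbert H b.

Lemma preh0 f : H f -> H 0.
Proof.
by move=> Hf; rewrite -(addNr f) -scaleN1r; exact: (preh_closed Hb).
Qed.

Lemma prehZ a f : H f -> H (a *: f).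
Proof.
move=> Hf; rewrite -[_ *: f]addr0; apply: (preh_closed Hb) => //.
exact: preh0 Hf.
Qed.

Lemma prehD f g : H f -> H g -> H (f + g).
Proof. by move=> *; rewrite -[f]scale1r; exact: (preh_closed Hb). Qed.

Lemma prehB f g : H f -> H g -> H (f - g).
Proof. by move=> *; rewrite addrC -scaleN1r; exact: (preh_closed Hb). Qed.

Lemma formDr f g h : H f -> H g -> H h -> b f (g + h) = b f g + b f h.
Proof. by move=> Hf Hg Hh; rewrite -{1}[g]scale1r (preh_linear Hb)// mul1r. Qed.

Lemma form0r f : H f -> b f 0 = 0.
Proof.
move=> Hf; have H0 := preh0 Hf; have := formDr Hf H0 H0.
by rewrite addr0 => /eqP; rewrite -subr_eq0 opprD addNKr oppr_eq0 => /eqP.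
Qed.

Lemma formZr a f g : H f -> H g -> b f (a *: g) = a * b f g.
Proof.
move=> Hf Hg; rewrite -[_ *: g]addr0 (preh_linear Hb)//; last exact: preh0 Hf.
by rewrite form0r// addr0.
Qed.

Lemma formBr f g h : H f -> H g -> H h -> b f (g - h) = b f g - b f h.
Proof.
move=> Hf Hg Hh; have HNh := prehZ (- 1) Hh.
by rewrite -[- h]scaleN1r formDr// formZr// mulN1r.
Qed.

Lemma formDl f g h : H f -> H g -> H h -> b (f + g) h = b f h + b g h.
Proof.
move=> Hf Hg Hh; have Hfg := prehD Hf Hg.
by rewrite (preh_sym Hb)// formDr// [b h f](preh_sym Hb)// [b h g](preh_sym Hb).
Qed.

Lemma formZl a f g : H f -> H g -> b (a *: f) g = a * b f g.
Proof.
move=> Hf Hg; have Haf := prehZ a Hf.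
by rewrite (preh_sym Hb)// formZr// (preh_sym Hb).
Qed.

Lemma formBl f g h : H f -> H g -> H h -> b (f - g) h = b f h - b g h.
Proof.
move=> Hf Hg Hh; have Hfg := prehB Hf Hg.
by rewrite (preh_sym Hb)// formBr// [b h f](preh_sym Hb)// [b h g](preh_sym Hb).
Qed.

Lemma formDZ t f g : H f -> H g ->
  b (f + t *: g) (f + t *: g) = b f f + 2 * t * b f g + t ^+ 2 * b g g.
Proof.
move=> Hf Hg; have Hg' := prehZ t Hg; have Hfg := prehD Hf Hg'.
rewrite formDr// !formDl// !formZl// !formZr// (preh_sym Hb Hg Hf); ring.
Qed.

Lemma form_cauchy_schwarz f g : H f -> H g -> b f g ^+ 2 <= b f f * b g g.
Proof.
move=> Hf Hg; apply: discriminant_le; first exact: preh_ge0 Hg.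
by move=> t; rewrite -formDZ//; apply: (preh_ge0 Hb); apply/prehD/prehZ.
Qed.

Lemma form_null f h : H f -> H h -> b f f = 0 -> b f h = 0.
Proof.
move=> Hf Hh f0; have := form_cauchy_schwarz Hf Hh; rewrite f0 mul0r => le0.
by apply/eqP; rewrite -sqrf_eq0 eq_le le0 sqr_ge0.
Qed.

(** The minimum of the quadratic functional [J g = b g g - 2 * phi g]
    represents [phi]. By the parallelogram law a minimizing sequence is
    Cauchy, and an [e]-minimizer already represents [phi] up to an error of
    order [sqrt e], so the limit represents it exactly. *)
Lemma riesz_representation (phi : V -> R) (M : R) : cauchy_complete H b ->
  H !=set0 ->
  (forall (a : R) f g, H f -> H g -> phi (a *: f + g) = a * phi f + phi g) ->
  (forall f, H f -> phi f ^+ 2 <= M * b f f) ->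
  exists2 g, H g & forall h, H h -> phi h = b g h.
Proof.
move=> cplH [z Hz] phil phiM; have H0 := preh0 Hz.
have phi0 : phi 0 = 0.
  have := phil 1 _ _ H0 H0; rewrite scale1r addr0 mul1r => /eqP.
  by rewrite -subr_eq0 opprD addNKr oppr_eq0 => /eqP.
have phiZ a f : H f -> phi (a *: f) = a * phi f.
  by move=> Hf; rewrite -[_ *: f]addr0 phil// phi0 addr0.
have phiD f g : H f -> H g -> phi (f + g) = phi f + phi g.
  by move=> Hf Hg; rewrite -{1}[f]scale1r phil// mul1r.
pose J g := b g g - 2 * phi g.
pose E := [set J g | g in H].
have Elb : has_inf E.
  split; first by exists (J z), z.
  (* because [2 * phi g <= phi g ^+ 2 / (|M| + 1) + (|M| + 1)] *)
  exists (- `|M| - 1) => _ [g Hg <-]; rewrite /J.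
  have := phiM _ Hg; have := preh_ge0 Hb Hg; have := ler_norm M.
  have := normr_ge0 M; set m := `|M|; set Q := b g g; set p := phi g.
  move=> m0 Mm Q0 pM.
  have pm : p ^+ 2 <= (m + 1) * Q.
    by apply: le_trans pM _; rewrite ler_wpM2r//; lra.
  have m1 : 0 < m + 1 by lra.
  rewrite -subr_ge0 -(pmulr_rge0 _ m1).
  apply: (@le_trans _ _ ((p - (m + 1)) ^+ 2)); first exact: sqr_ge0.
  rewrite -subr_ge0 (_ : _ - _ = (m + 1) * Q - p ^+ 2) ?subr_ge0//; ring.
pose i := inf E.
have Ji g : H g -> i <= J g by move=> Hg; apply: ge_inf; [exact: Elb.2|exists g].
have near_min e : 0 < e -> exists2 g, H g & J g < i + e.
  by move=> e0; have [_ [g Hg <-] ?] := inf_adherent e0 Elb; exists g.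
have JDZ t f g : H f -> H g ->
    J (f + t *: g) = J f + 2 * t * (b f g - phi g) + t ^+ 2 * b g g.
  move=> Hf Hg; rewrite /J formDZ// phiD// ?phiZ//; last exact: prehZ.
  by ring.
have euler e f h : 0 < e -> H f -> H h -> J f < i + e ->
    (b f h - phi h) ^+ 2 <= e * b h h.
  move=> e0 Hf Hh Jf; apply: discriminant_le; first exact: preh_ge0 Hh.
  move=> t; have := Ji _ (prehD Hf (prehZ t Hh)); rewrite JDZ//; lra.
have paral e f g : 0 < e -> H f -> H g -> J f < i + e -> J g < i + e ->
    b (f - g) (f - g) < 4 * e.
  move=> e0 Hf Hg Jf Jg; have Hgf := prehB Hg Hf.
  have := Ji _ (prehD Hf (prehZ 2^-1 Hgf)).
  have JgE : J g = J (f + 1 *: (g - f)) by rewrite scale1r addrC subrK.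
  move: Jg; rewrite JgE !JDZ//.
  have -> : b (f - g) (f - g) = b (g - f) (g - f).
    have Hgf' := prehZ (- 1) Hgf.
    rewrite (_ : f - g = - 1 *: (g - f)); last by rewrite scaleN1r opprB.
    by rewrite formZl// formZr// !mulN1r opprK.
  set X := b f _ - _; set Y := b (g - f) _; lra.
have /choice[u uP] n : exists g, H g /\ J g < i + n.+1%:R^-1.
  by have [|g] := near_min n.+1%:R^-1; [rewrite invr_gt0|exists g].
have small e : 0 < e -> exists N, forall n, (N <= n)%N -> n.+1%:R^-1 < e :> R.
  move=> e0; exists (Num.truncn e^-1) => n; rewrite -ltnS => Nn.
  rewrite invf_plt ?posrE//; apply: lt_le_trans (truncnS_gt _) _.
  by rewrite ler_nat.
have uH n : H (u n) by case: (uP n).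
have ule e : 0 < e -> exists N, forall n, (N <= n)%N -> J (u n) < i + e.
  move=> e0; have [N hN] := small _ e0; exists N => n Nn.
  by apply: lt_trans (uP n).2 _; rewrite ltrD2l hN.
have [|l Hl ul] := cplH u uH.
  move=> e e0; have [|N hN] := ule (e / 4); first by rewrite divr_gt0.
  exists N => m n Nm Nn; rewrite (_ : e = 4 * (e / 4)); last by field.
  by apply: paral => //; [rewrite divr_gt0|exact: hN|exact: hN].
exists l => // h Hh.
apply/eqP; rewrite eq_sym -subr_eq0 -sqrf_eq0 eq_le sqr_ge0 andbT.
have Q0 := preh_ge0 Hb Hh.
apply/ler_addgt0Pr => e e0; rewrite add0r.
pose d := e / (4 * (b h h + 1)).
have Q1 : 0 < b h h + 1 by rewrite ltr_wpDl.
have d0 : 0 < d by rewrite divr_gt0// mulr_gt0.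
have [N1 hN1] := ul _ d0; have [N2 hN2] := ule _ d0.
pose n := maxn N1 N2.
have h1 := hN1 n (leq_maxl _ _).
have h2 := euler _ _ _ d0 (uH n) Hh (hN2 n (leq_maxr _ _)).
have h3 := form_cauchy_schwarz (prehB (uH n) Hl) Hh.
have -> : b l h - phi h = (b (u n) h - phi h) - b (u n - l) h.
  by rewrite formBl//; ring.
have de : e = 4 * d * (b h h + 1) by rewrite /d; field; rewrite gt_eqF.
move: h1 h2 h3; set x := b (u n) h - _; set y := b (u n - l) h.
set q := b (u n - l) _ => qd xd yq.
have {}yq : y ^+ 2 <= d * b h h.
  by apply: le_trans yq _; rewrite ler_wpM2r// ltW.
have : 0 <= (x + y) ^+ 2 by exact: sqr_ge0.
rewrite de; move: d0 xd yq; clearbody d x y; clear.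
set Q' := b h h => d0 xd yq xy; lra.
Qed.

End Theory.

Section Operator.
Variables (H : set V) (b : V -> V -> R).
Hypothesis Hb : prehilbert H b.

(** The symmetric case of the Lax-Milgram theorem: [b f (A g)] is a second
    complete inner product, and representing [h |-> b f h] in it inverts [A]. *)
Lemma coercive_surjective (A : V -> V) (a M : R) : cauchy_complete H b ->
  (forall f, H f -> H (A f)) ->
  (forall (c : R) f g h, H f -> H g -> H h ->
     b f (A (c *: g + h)) = c * b f (A g) + b f (A h)) ->
  (forall f g, H f -> H g -> b f (A g) = b (A f) g) ->
  (forall f, H f -> b f (A f) <= M * b f f) ->
  0 < a -> (forall f, H f -> a * b f f <= b f (A f)) ->
  forall f, H f -> exists2 g, H g & forall h, H h -> b (A g) h = b f h.
Proof.
move=> cplH HA linA symA AM a0 coerA f Hf.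
pose bA f g := b f (A g).
have HbA : prehilbert H bA.
  split; [exact: preh_closed Hb| |by move=> *; exact: linA|].
  - by move=> f1 g1 Hf1 Hg1; rewrite /bA symA// (preh_sym Hb)//; exact: HA.
  - move=> f1 Hf1; apply: le_trans (coerA _ Hf1).
    by rewrite mulr_ge0 ?(preh_ge0 Hb)// ltW.
have cplA : cauchy_complete H bA.
  move=> u uH uC; have [|l Hl ul] := cplH u uH.
    move=> e e0; have [|N hN] := uC (a * e); first by rewrite mulr_gt0.
    exists N => m n Nm Nn; rewrite -(ltr_pM2l a0).
    by apply: le_lt_trans (coerA _ _) (hN _ _ Nm Nn); exact: (prehB Hb).
  exists l => // e e0; pose m := `|M| + 1.
  have m0 : 0 < m by rewrite ltr_pwDr.
  have [|N hN] := ul (e / m); first by rewrite divr_gt0.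
  exists N => n Nn; have Hul := prehB Hb (uH n) Hl.
  apply: le_lt_trans (AM _ Hul) _.
  have := hN _ Nn; rewrite ltr_pdivlMr// mulrC; apply: le_lt_trans.
  by rewrite ler_wpM2r ?(preh_ge0 Hb)// (le_trans (ler_norm M))// /m lerDl.
have [g Hg gP] : exists2 g, H g & forall h, H h -> b f h = bA g h.
  apply: (@riesz_representation H bA HbA (b f) (b f f / a) cplA).
  - by exists f.
  - by move=> c g h Hg Hh; rewrite (preh_linear Hb).
  - move=> h Hh; apply: le_trans (form_cauchy_schwarz Hb Hf Hh) _.
    by rewrite -mulrA ler_wpM2l ?(preh_ge0 Hb)// ler_pdivlMl//; exact: coerA.
by exists g => // h Hh; rewrite gP// -symA.
Qed.

(** Cauchy-Schwarz for the form [b f (A g)] bounds [b (A f) (A f)] by a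
    multiple of [b f (A f)], so that [A] fails to be bounded below as
    soon as [b f (A f)] can be small compared to [b f f]. *)
Lemma bounded_below_coercive (A : V -> V) (a M : R) :
  (forall f, H f -> H (A f)) ->
  (forall (c : R) f g h, H f -> H g -> H h ->
     b f (A (c *: g + h)) = c * b f (A g) + b f (A h)) ->
  (forall f g, H f -> H g -> b f (A g) = b (A f) g) ->
  (forall f, H f -> b (A f) (A f) <= M ^+ 2 * b f f) ->
  (forall f, H f -> 0 <= b f (A f)) ->
  0 < a -> (forall f, H f -> a * b f f <= b (A f) (A f)) ->
  exists2 a', 0 < a' & forall f, H f -> a' * b f f <= b f (A f).
Proof.
move=> HA linA symA AM posA a0 lowA.
pose bA f g := b f (A g).
have HbA : prehilbert H bA.
  split; [exact: preh_closed Hb| |by move=> *; exact: linA|exact: posA].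
  by move=> f1 g1 Hf1 Hg1; rewrite /bA symA// (preh_sym Hb)//; exact: HA.
have M1 : 0 < `|M| + 1 by rewrite ltr_pwDr.
exists (a / (`|M| + 1)); first by rewrite divr_gt0.
move=> f Hf; have HAf := HA _ Hf.
rewrite mulrAC ler_pdivrMr//; apply: le_trans (lowA _ Hf) _.
set r := b (A f) (A f); set p := b f (A f).
have r0 : 0 <= r by exact: preh_ge0 Hb _ HAf.
have p0 : 0 <= p by exact: posA.
have rp : r ^+ 2 <= p * b (A f) (A (A f)).
  by rewrite mulrC; have := form_cauchy_schwarz HbA HAf Hf.
have sM : b (A f) (A (A f)) <= (`|M| + 1) * r.
  apply: (@le_trans _ _ (`|M| * r)); last by apply: ler_wpM2r => //; rewrite lerDl.
  have s0 : 0 <= b (A f) (A (A f)) by exact: posA.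
  have Mr0 : 0 <= `|M| * r by rewrite mulr_ge0.
  rewrite -ler_sqr ?nnegrE//.
  apply: le_trans (form_cauchy_schwarz Hb HAf (HA _ HAf)) _.
  rewrite exprMn [_ ^+ 2 * _]mulrC expr2 -mulrA ler_wpM2l//.
  rewrite mulrC real_normK ?num_real//.
  exact: AM.
have [->|rn0] := eqVneq r 0; first by rewrite mulr_ge0// ltW.
have r_gt0 : 0 < r by rewrite lt_def rn0.
rewrite -(ler_pM2r r_gt0) -expr2; apply: le_trans rp _.
by rewrite -mulrA ler_wpM2l.
Qed.

End Operator.
End PreHilbert.

(** * Square-integrable real functions *)

Section SquareIntegrable.
Context {d : measure_display} {T : measurableType d} {R : realType}.
Variable mu : {measure set T -> \bar R}.
Implicit Types u v w : T -> R.

Lemma ae_integrable_le u v : measurable_fun [set: T] u ->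
  {ae mu, forall x, `|u x| <= v x} -> mu.-integrable [set: T] (EFin \o v) ->
  mu.-integrable [set: T] (EFin \o u).
Proof.
move=> mu_ uv /integrableP[mv iv]; apply/integrableP; split.
  exact/measurable_EFinP.
apply: le_lt_trans iv; apply: ae_ge0_le_integral => //.
- by apply: measurableT_comp => //; exact/measurable_EFinP.
- exact: measurableT_comp.
- apply: filterS uv => x uvx _.
  by rewrite /= lee_fin (le_trans uvx)// ler_norm.
Qed.

Lemma integrable_cst (c : R) : (mu [set: T] < +oo)%E ->
  mu.-integrable [set: T] (EFin \o cst c).
Proof.
move=> muoo; apply/integrableP; split; first exact/measurable_EFinP.
under eq_integral do rewrite /=.
by rewrite integral_cst// lte_mul_pinfty.
Qed.

Lemma EFin_Rintegral u : mu.-integrable [set: T] (EFin \o u) ->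
  (\int[mu]_x u x)%:E = (\int[mu]_x (u x)%:E)%E.
Proof. by move=> iu; rewrite /Rintegral fineK//; exact: integrable_fin_num. Qed.

Lemma RintegrableD u v : mu.-integrable [set: T] (EFin \o u) ->
  mu.-integrable [set: T] (EFin \o v) ->
  mu.-integrable [set: T] (EFin \o (fun x => u x + v x)).
Proof.
move=> iu iv; rewrite (_ : EFin \o _ = (EFin \o u) \+ (EFin \o v))%E//.
exact: integrableD.
Qed.

Lemma RintegrableZ (a : R) u : mu.-integrable [set: T] (EFin \o u) ->
  mu.-integrable [set: T] (EFin \o (fun x => a * u x)).
Proof.
move=> iu; rewrite (_ : EFin \o _ = fun x => a%:E * (EFin \o u) x)%E//.
exact: integrableZl.
Qed.

Lemma ae_eq_Rintegral u v : measurable_fun [set: T] u ->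
  measurable_fun [set: T] v -> u = v %[ae mu] ->
  \int[mu]_x u x = \int[mu]_x v x.
Proof.
move=> mu_ mv uv; congr fine; apply: ae_eq_integral => //; first exact/measurable_EFinP.
- exact/measurable_EFinP.
- by apply: filterS uv => x /[apply] ->.
Qed.

Lemma ae_le_Rintegral u v : mu.-integrable [set: T] (EFin \o u) ->
  mu.-integrable [set: T] (EFin \o v) -> {ae mu, forall x, u x <= v x} ->
  \int[mu]_x u x <= \int[mu]_x v x.
Proof.
move=> iu iv uv; rewrite -subr_ge0 -RintegralB//.
have mB : measurable_fun [set: T] (fun x => v x - u x).
  by apply: measurable_funB; apply/measurable_EFinP;
    [case/integrableP: iv|case/integrableP: iu].
rewrite (@ae_eq_Rintegral _ (fun x => `|v x - u x|)); first exact: Rintegral_ge0.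
- by [].
- exact: measurableT_comp.
- by apply: filterS uv => x uvx _; rewrite ger0_norm// subr_ge0.
Qed.

Definition sqint u := measurable_fun [set: T] u /\
  mu.-integrable [set: T] (EFin \o (fun x => u x ^+ 2)).

Lemma sqint_mul u v : sqint u -> sqint v ->
  mu.-integrable [set: T] (EFin \o (fun x => u x * v x)).
Proof.
move=> [mu_ iu] [mv iv]; apply: ae_integrable_le (RintegrableD iu iv).
  exact: measurable_funM.
apply/aeW => x; rewrite normrM.
rewrite -(real_normK (num_real (u x))) -(real_normK (num_real (v x))).
have := sqr_ge0 (`|u x| - `|v x|); have := sqr_ge0 (`|u x| + `|v x|); lra.
Qed.

Lemma sqint_linear (a : R) u v : sqint u -> sqint v ->
  sqint (fun x => a * u x + v x).
Proof.
move=> Hu Hv; have [mu_ iu] := Hu; have [mv iv] := Hv.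
split; first by apply: measurable_funD => //; exact: measurable_funM.
have i1 := RintegrableZ (a ^+ 2) iu.
have i2 := RintegrableZ (2 * a) (sqint_mul Hu Hv).
have := RintegrableD (RintegrableD i1 i2) iv.
by congr (mu.-integrable _ _); apply/funext => x /=; congr EFin; ring.
Qed.

(** Functions are taken with values in [R^o] so that they form a real vector
    space. *)
Definition rdot (u v : T -> R^o) : R := \int[mu]_x (u x * v x).

Lemma rdot_prehilbert : prehilbert (sqint : set (T -> R^o)) rdot.
Proof.
split.
- by move=> a u v; exact: sqint_linear.
- by move=> u v _ _; apply: eq_Rintegral => x _; rewrite mulrC.
- move=> a u v w Hu Hv Hw; rewrite /rdot.
  have iuv := sqint_mul Hu Hv; have iuw := sqint_mul Hu Hw.
  rewrite -RintegralZl// -RintegralD//; last exact: RintegrableZ.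
  by apply: eq_Rintegral => x _; rewrite mulrDr mulrCA.
- by move=> u _; apply: Rintegral_ge0 => x _; rewrite -expr2 sqr_ge0.
Qed.

Lemma rdot_EFin u : sqint u ->
  (rdot u u)%:E = (\int[mu]_x (u x ^+ 2)%:E)%E.
Proof.
move=> [_ iu]; rewrite /rdot /Rintegral.
under eq_integral do rewrite -expr2.
by rewrite fineK//; exact: integrable_fin_num.
Qed.

Lemma rdot_null u : sqint u -> rdot u u = 0 -> u = cst 0 %[ae mu].
Proof.
move=> Hu u0; have [mu_ _] := Hu; have := rdot_EFin Hu; rewrite u0 => /esym i0.
have m2 : measurable_fun [set: T] (fun x => (u x ^+ 2)%:E).
  by apply/measurable_EFinP; exact: measurable_funX.
have : (\int[mu]_x `|(u x ^+ 2)%:E| = 0)%E.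
  by apply: etrans i0; apply: eq_integral => x _; rewrite gee0_abs// lee_fin sqr_ge0.
move/(ae_eq_integral_abs mu measurableT m2); apply: filterS => x /[apply] -[].
by move=> /eqP; rewrite sqrf_eq0 => /eqP.
Qed.

Lemma sqint_cst (c : R) : (mu [set: T] < +oo)%E -> sqint (cst c).
Proof. by split => //; exact: integrable_cst (c ^+ 2) _. Qed.

Lemma sqint_integrable u : (mu [set: T] < +oo)%E -> sqint u ->
  mu.-integrable [set: T] (EFin \o u).
Proof.
move=> /(sqint_cst 1) /sqint_mul h /h.
by under [EFin \o _]eq_fun do rewrite /= mul1r.
Qed.

Lemma sqint_normr u : sqint u -> sqint (Num.norm \o u).
Proof.
move=> [mu_ iu]; split; first exact: measurableT_comp.
by under [EFin \o _]eq_fun do rewrite /= real_normK ?num_real//.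
Qed.

Lemma Rintegral_sqr_le u : (mu [set: T] < +oo)%E -> sqint u ->
  (\int[mu]_x u x) ^+ 2 <= fine (mu [set: T]) * rdot u u.
Proof.
move=> muoo Hu; have := form_cauchy_schwarz rdot_prehilbert (sqint_cst 1 muoo) Hu.
have -> : rdot (cst 1) (cst 1) = fine (mu [set: T]).
  transitivity (\int[mu]_(x in [set: T]) (1 : R)).
    by apply: eq_Rintegral => x _; rewrite mulr1.
  by rewrite Rintegral_cst// mul1r.
congr (_ <= _); congr (_ ^+ 2).
by apply: eq_Rintegral => x _; rewrite mul1r.
Qed.

End SquareIntegrable.

Section Completeness.
Context {d : measure_display} {T : measurableType d} {R : realType}.
Variable mu : probability T R.
Implicit Types u v w : T -> R.

Lemma probability_lty : (mu [set: T] < +oo)%E.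
Proof. by rewrite [X in (X < _)%E](probability_setT mu) ltry. Qed.

(** A subsequence whose increments have summable norms converges almost
    everywhere, because the sum of the absolute increments is integrable;
    Fatou's lemma transfers the Cauchy bounds to the limit. *)
Lemma sqint_complete : cauchy_complete (sqint mu : set (T -> R^o)) (rdot mu).
Proof.
move=> u Hu uC.
have Hpre := rdot_prehilbert mu.
(* the increments of the subsequence have L^1 norm at most [2 ^ - k] *)
pose eps k : R := (2^-1 ^+ k) ^+ 2.
have eps0 k : 0 < eps k by rewrite exprn_gt0// exprn_gt0// invr_gt0.
have /choice[N NP] k := uC _ (eps0 k).
pose n_ k := (\sum_(j < k.+1) (N j).+1)%N.
have nN k : (N k <= n_ k)%N by rewrite /n_ big_ord_recr/= addnS -addSn leq_addl.
have nS k : (n_ k <= n_ k.+1)%N by rewrite /n_ [leqRHS]big_ord_recr/= leq_addr.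
have kn k : (k <= n_ k)%N.
  elim: k => [//|k IH]; rewrite /n_ big_ord_recr/= addnS ltnS.
  by rewrite (leq_trans IH)// leq_addr.
pose w k := u (n_ k).
have Hw k : sqint mu (w k) by exact: Hu.
pose dw k : T -> R := w k.+1 - w k.
have Hdw k : sqint mu (dw k) by exact: (prehB Hpre).
have intdw k : (\int[mu]_x `|(dw k x)%:E| <= (2^-1 ^+ k)%:E)%E.
  have H1 := sqint_normr (Hdw k).
  have i1 := sqint_integrable probability_lty H1.
  have -> : (\int[mu]_x `|(dw k x)%:E| = (\int[mu]_x (Num.norm \o dw k) x)%:E)%E.
    by rewrite /Rintegral fineK//; exact: integrable_fin_num.
  rewrite lee_fin -ler_sqr ?nnegrE ?exprn_ge0 ?invr_ge0//; last first.
    by apply: Rintegral_ge0 => x _ /=.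
  apply: le_trans (Rintegral_sqr_le probability_lty H1) _; apply/ltW.
  rewrite [X in fine X](probability_setT mu) mul1r.
  have -> : rdot mu (Num.norm \o dw k) (Num.norm \o dw k) = rdot mu (dw k) (dw k).
    by apply: eq_Rintegral => x _ /=; rewrite -!expr2 real_normK ?num_real.
  by apply: NP; [exact: leq_trans (nN k) (nS k)|exact: nN].
have sumdw : (\int[mu]_x (\sum_(k <oo) `|(dw k x)%:E|) < +oo)%E.
  rewrite integral_nneseries//; last first.
    by move=> k; apply: measurableT_comp => //; apply/measurable_EFinP; case: (Hdw k).
  apply: (@le_lt_trans _ _ (\sum_(k <oo) (2^-1 ^+ k)%:E)%E).
    by apply: lee_nneseries => // k; rewrite integral_ge0.
  have -> : (\sum_(k <oo) (2^-1 ^+ k)%:E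
      = (limn (series (geometric 1 (2^-1 : R))))%:E)%E.
    rewrite -EFin_lim; last first.
      by apply: is_cvg_geometric_series; rewrite ger0_norm ?invf_lt1 ?ltr1n.
    apply: (f_equal (fun g : nat -> \bar R => limn g)).
    apply/funext => n /=; rewrite /series/= -sumEFin.
    by apply: eq_bigr => k _; rewrite mul1r.
  exact: ltry.
have mdw k : measurable_fun [set: T] (fun x => `|(dw k x)%:E|)%E.
  by apply: measurableT_comp => //; apply/measurable_EFinP; case: (Hdw k).
have msum : measurable_fun [set: T] (fun x => \sum_(k <oo) `|(dw k x)%:E|)%E.
  by apply: ge0_emeasurable_sum.
have isum : mu.-integrable [set: T] (fun x => \sum_(k <oo) `|(dw k x)%:E|)%E.
  apply/integrableP; split => //; apply: le_lt_trans sumdw.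
  apply: ge0_le_integral => //; first exact: measurableT_comp.
  by move=> x _; rewrite gee0_abs//; exact: nneseries_ge0.
pose l x : R := fine (limn_esup (fun k => (w k x)%:E)).
have aecvg : {ae mu, forall x, w^~ x @ \oo --> l x}.
  have := integrable_ae measurableT isum; apply: filterS => x /(_ I) finx.
  have cw : cvgn (w^~ x : nat -> R^o).
    have : cvgn (series (dw ^~ x : nat -> R^o)).
      apply: normed_cvg; apply: nondecreasing_is_cvgn.
        by apply: nondecreasing_series => n _ _ /=; exact: normr_ge0.
      exists (fine (\sum_(k <oo) `|(dw k x)%:E|)%E) => _ [n _ <-].
      rewrite -lee_fin fineK// [leLHS](_ : _ = \sum_(0 <= k < n) `|(dw k x)%:E|)%E.
        exact: nneseries_lim_ge.
      by rewrite /= /series/= -sumEFin; apply: eq_bigr.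
    have -> : series (dw ^~ x : nat -> R^o) = (fun n => w n x - w 0%N x).
      by apply/funext => n; rewrite /series/= telescope_sumr.
    move=> c1; have -> : w^~ x = (fun n => (w n x - w 0%N x) + w 0%N x).
      by apply/funext => n; rewrite subrK.
    apply: is_cvgD => //; exact: is_cvg_cst.
  have ecw : (w k x)%:E @[k --> \oo] --> (limn (w^~ x))%:E.
    by apply: cvg_EFin => //; exact: nearW.
  have -> : l x = limn (w^~ x).
    rewrite /l is_cvg_limn_esupE; first by rewrite (cvg_lim _ ecw).
    by apply/cvg_ex; exists (limn (w^~ x))%:E.
  exact: cw.
have ml : measurable_fun [set: T] l.
  apply: measurableT_comp => //; apply: measurable_fun_limn_esup => k.
  by apply/measurable_EFinP; case: (Hw k).
have mu_n n : measurable_fun [set: T] (u n) by case: (Hu n).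
have key e : 0 < e -> exists N, forall n, (N <= n)%N ->
    sqint mu (u n \- l) /\ rdot mu (u n \- l) (u n \- l) <= e.
  move=> e0; have [M MP] := uC _ e0; exists M => n Mn.
  have mn : measurable_fun [set: T] (u n \- l) by exact: measurable_funB.
  pose f k x : \bar R := ((u n x - w (k + M)%N x : R) ^+ 2)%:E.
  have mf k : measurable_fun [set: T] (f k).
    by apply/measurable_EFinP/measurable_funX/measurable_funB => //; exact: mu_n.
  have f0 k x : (0 <= f k x)%E by rewrite lee_fin sqr_ge0.
  have einf_ge0 x : (0 <= limn_einf (f^~ x))%E.
    rewrite limn_einf_lim; apply: lime_ge; first exact: is_cvg_einfs.
    by apply: nearW => k; apply: le_ereal_inf_tmp => _ [m _ <-].
  have bound : (\int[mu]_x ((u n x - l x) ^+ 2)%:E <= e%:E)%E.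
    have -> : (\int[mu]_x ((u n x - l x) ^+ 2)%:E = \int[mu]_x limn_einf (f^~ x))%E.
      apply: ge0_ae_eq_integral => //.
      - by apply/measurable_EFinP; exact: measurable_funX.
      - apply: measurableT_comp => //; apply: measurable_fun_limn_esup => k.
        by apply: measurableT_comp => //; exact: mf.
      - by move=> x _; rewrite lee_fin sqr_ge0.
      - apply: filterS aecvg => x wl _; apply/esym.
        suff : f k x @[k --> \oo] --> ((u n x - l x) ^+ 2)%:E.
          by move=> /cvg_limn_einf_sup[].
        apply: cvg_EFin; first exact: nearW.
        have wl' : w (k + M)%N x @[k --> \oo] --> l x.
          by have := cvg_comp _ _ (cvg_addnr M) wl.
        have c : u n x - w (k + M)%N x @[k --> \oo] --> (u n x - l x : R^o).
          by apply: cvgB => //; exact: cvg_cst.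
        by rewrite expr2; exact: cvgM.
    apply: le_trans (fatou mu measurableT mf (fun k x _ => f0 k x)) _.
    rewrite limn_einf_lim; apply: lime_le; first exact: is_cvg_einfs.
    apply: nearW => k; apply: (@le_trans _ _ (\int[mu]_x f k x)%E).
      by apply: ereal_inf_lbound; exists k => /=.
    have Huw : sqint mu (u n - w (k + M)%N) by exact: (prehB Hpre).
    rewrite -(rdot_EFin Huw) lee_fin; apply/ltW/MP => //.
    exact: leq_trans (leq_addl k M) (kn _).
  have Hunl : sqint mu (u n \- l).
    split => //; apply/integrableP; split.
      by apply/measurable_EFinP; exact: measurable_funX.
    apply: (@le_lt_trans _ _ e%:E); last exact: ltry.
    apply: le_trans bound; apply: ge0_le_integral => //.
    - by apply: measurableT_comp => //; apply/measurable_EFinP; exact: measurable_funX.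
    - by apply/measurable_EFinP; exact: measurable_funX.
    - by move=> x _; rewrite /= ger0_norm// sqr_ge0.
  by split=> //; rewrite -lee_fin rdot_EFin.
have Hl : sqint mu l.
  have [N0 /(_ N0 (leqnn _))[HN _]] := key 1 ltr01.
  rewrite (_ : l = (u N0 : T -> R^o) - (u N0 \- l)); first exact: (prehB Hpre).
  by apply/funext => x /=; rewrite /GRing.add/= /GRing.opp/= opprB addrC subrK.
exists l => // e e0; have [|N0 N0P] := key (e / 2); first by rewrite divr_gt0.
exists N0 => n Nn; apply: le_lt_trans (N0P _ Nn).2 _.
by rewrite ltr_pdivrMr// ltr_pMr// ltr1n.
Qed.
End Completeness.

(** * The generator on real functions *)

Section VarianceBound.
Context {d : measure_display} {T : measurableType d} {R : realType}.
Variable m : {measure set T -> \bar R}.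

(** Expanding [\int (u - a)^2 = \int u^2 - a^2 m(T) - 2 a \int (u - a)] turns
    Cauchy-Schwarz for [u - a] into a bound with no double integral. *)
Lemma Rintegral_sub_sqr_le (u : T -> R) (a Q : R) :
  (m [set: T] <= Q%:E)%E -> sqint m u ->
  (\int[m]_y (u y - a)) ^+ 2 <=
    Q * (\int[m]_y (u y ^+ 2) - fine (m [set: T]) * a ^+ 2
         - 2 * a * \int[m]_y (u y - a)).
Proof.
move=> mQ Hu; have moo : (m [set: T] < +oo)%E by rewrite (le_lt_trans mQ) ?ltry.
have H1 := sqint_cst 1 moo.
have Hua : sqint m (fun y => u y - a).
  have := sqint_linear (- a) H1 Hu; congr (sqint m); apply/funext => y /=; ring.
have iu2 := Hu.2; have iua := sqint_integrable moo Hua.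
have ia c := integrable_cst c moo.
set w := \int[m]_y (u y - a).
have E : rdot m (fun y => u y - a) (fun y => u y - a) =
    \int[m]_y (u y ^+ 2) - fine (m [set: T]) * a ^+ 2 - 2 * a * w.
  transitivity (\int[m]_y (u y ^+ 2 + ((- 2 * a) * (u y - a) + (- a ^+ 2)))).
    by apply: eq_Rintegral => y _; ring.
  have i2 := RintegrableZ (- 2 * a) iua.
  rewrite RintegralD//; last exact: (RintegrableD i2 (ia (- a ^+ 2))).
  rewrite RintegralD//; last exact: (ia (- a ^+ 2)).
  by rewrite RintegralZl// Rintegral_cst// -/w; ring.
rewrite -E; apply: le_trans (Rintegral_sqr_le moo Hua) _.
apply: ler_wpM2r; first exact: (preh_ge0 (rdot_prehilbert m)).
by rewrite -lee_fin fineK// ge0_fin_numE.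
Qed.
End VarianceBound.

Section RealGenerator.
Context {d : measure_display} {S : measurableType d} {R : realType}.
Variables (q : R.-ker S ~> S) (mu : probability S R) (Q : R).
Implicit Types u v h : S -> R.
Hypothesis q_fin : forall x, fin_num_fun (q x).
Hypothesis q_le : {ae mu, forall x, (q x [set: S] <= Q%:E)%E}.

Definition real_generator u x : R := \int[q x]_y (u y - u x).
Definition rate x : R := fine (q x [set: S]).

Hypothesis mu_inv : forall h, measurable_fun [set: S] h ->
  (exists M, forall x, `|h x| <= M) -> \int[mu]_x real_generator h x = 0.

Let q_lty x : (q x [set: S] < +oo)%E.
Proof. by rewrite -ge0_fin_numE// q_fin. Qed.

Lemma measurable_rate : measurable_fun [set: S] rate.
Proof. by apply: measurableT_comp => //; exact: measurable_kernel. Qed.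

Lemma measurable_kernel_integral u : measurable_fun [set: S] u ->
  measurable_fun [set: S] (fun x => \int[q x]_y (u y)%:E)%E.
Proof.
move=> mu_; have mE : measurable_fun [set: S] (EFin \o u) by exact/measurable_EFinP.
under eq_fun do rewrite integralE.
apply: emeasurable_funB; apply: measurable_fun_integral_kernel => //.
- by move=> U mU; exact: measurable_kernel.
- exact: measurable_funepos.
- by move=> U mU; exact: measurable_kernel.
- exact: measurable_funeneg.
Qed.

(** When [u] is not [q x]-integrable, neither is [u - u x], and the real-valued
    integral takes the default value 0. *)
Lemma real_generatorE u x : measurable_fun [set: S] u ->
  real_generator u x = if (\int[q x]_y `|(u y)%:E| < +oo)%E
    then \int[q x]_y u y - rate x * u x else 0.
Proof.
move=> mu_; have icst := integrable_cst (- u x) (q_lty x).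
case: ifPn => [uoo|nuoo].
  have iu : (q x).-integrable [set: S] (EFin \o u).
    by apply/integrableP; split; first exact/measurable_EFinP.
  by rewrite /real_generator RintegralD// Rintegral_cst// /rate mulNr mulrC.
rewrite /real_generator /Rintegral.
suff : (\int[q x]_y (u y - u x)%:E)%E \isn't a fin_num.
  by rewrite fin_numE; case: integral.
apply: contra nuoo; rewrite -integral_fin_num_abs//; last exact: measurable_funB.
move=> h; have iB : (q x).-integrable [set: S] (EFin \o (fun y => u y - u x)).
  by apply/integrableP; split => //; apply/measurable_EFinP; exact: measurable_funB.
have := RintegrableD iB (integrable_cst (u x) (q_lty x)).
by under [EFin \o _]eq_fun do rewrite /= subrK; case/integrableP.
Qed.

Lemma measurable_real_generator u : measurable_fun [set: S] u ->
  measurable_fun [set: S] (real_generator u).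
Proof.
move=> mu_; rewrite (funext (fun x => real_generatorE x mu_)).
apply: measurable_fun_ifT => //.
- apply: measurable_fun_lte => //; apply: measurable_fun_integral_kernel => //.
    by move=> U mU; exact: measurable_kernel.
  by apply: measurableT_comp => //; exact/measurable_EFinP.
- apply: measurable_funB; last by apply: measurable_funM => //; exact: measurable_rate.
  by apply: measurableT_comp => //; exact: measurable_kernel_integral.
Qed.

Lemma ae_rate_le : {ae mu, forall x, 0 <= rate x <= Q}.
Proof.
apply: filterS q_le => x qx; rewrite fine_ge0//= -lee_fin fineK//.
by rewrite ge0_fin_numE.
Qed.

Lemma integrable_rate_mul u : mu.-integrable [set: S] (EFin \o u) ->
  mu.-integrable [set: S] (EFin \o (fun x => rate x * u x)).
Proof.
move=> /[dup] /integrableP[/measurable_EFinP mu_ _] iu.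
have := integrable_norm iu; move/(RintegrableZ Q); apply: ae_integrable_le.
  by apply: measurable_funM => //; exact: measurable_rate.
apply: filterS ae_rate_le => x /andP[r0 rQ].
by rewrite normrM (ger0_norm r0) ler_wpM2r.
Qed.

(** Stationarity as a balance equation: the flux of [mu] into a set equals the
    flux out of it, here tested against a function. *)
Lemma invariance_bounded h (M : R) : measurable_fun [set: S] h ->
  (forall x, 0 <= h x <= M) ->
  (\int[mu]_x \int[q x]_y (h y)%:E = \int[mu]_x (rate x * h x)%:E)%E.
Proof.
move=> mh hM; have h0 x : 0 <= h x by case/andP: (hM x).
have hleM x : h x <= M by case/andP: (hM x).
have ih : mu.-integrable [set: S] (EFin \o h).
  apply: ae_integrable_le (integrable_cst M (probability_lty mu)) => //.
  by apply/aeW => x; rewrite ger0_norm.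
have iqh x : (q x).-integrable [set: S] (EFin \o h).
  apply: ae_integrable_le (integrable_cst M (q_lty x)) => //.
  by apply/aeW => y; rewrite ger0_norm.
have mK : measurable_fun [set: S] (fun x => \int[q x]_y h y).
  by apply: measurableT_comp => //; exact: measurable_kernel_integral.
have irh := integrable_rate_mul ih.
have iK : mu.-integrable [set: S] (EFin \o (fun x => \int[q x]_y h y)).
  have := integrable_rate_mul (integrable_cst M (probability_lty mu)).
  apply: ae_integrable_le => //; apply/aeW => x.
  rewrite ger0_norm; last exact: Rintegral_ge0.
  have -> : rate x * cst M x = \int[q x]_(y in [set: S]) M.
    by rewrite Rintegral_cst// mulrC.
  apply: le_Rintegral => //; exact: integrable_cst (q_lty x).
under eq_integral do rewrite -EFin_Rintegral//.
have hb : exists M, forall x, `|h x| <= M by exists M => x; rewrite ger0_norm.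
have rE x : real_generator h x = \int[q x]_y h y - rate x * h x.
  by rewrite real_generatorE// ifT//; case/integrableP: (iqh x).
have := mu_inv mh hb; under eq_Rintegral do rewrite rE.
rewrite RintegralB// => /eqP; rewrite subr_eq0 => /eqP K0.
by rewrite -!EFin_Rintegral// K0.
Qed.

(** By monotone convergence along the truncations of [h]; both sides may be
    infinite. *)
Lemma invariance_nonneg h : measurable_fun [set: S] h -> (forall x, 0 <= h x) ->
  (\int[mu]_x \int[q x]_y (h y)%:E = \int[mu]_x (rate x * h x)%:E)%E.
Proof.
move=> mh h0.
pose hn n x := Order.min (h x) n%:R.
have mhn n : measurable_fun [set: S] (hn n) by exact: measurable_minr.
have hn0 n x : 0 <= hn n x by rewrite /hn le_min h0 ler0n.
have hn_nd x : {homo (fun n => hn n x) : m n / (m <= n)%N >-> m <= n}.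
  by move=> m n mn; rewrite /hn le_min2// ler_nat.
have hn_cvg x : \forall n \near \oo, hn n x = h x.
  near=> n; apply/min_idPl; near: n.
  exact: (nbhs_infty_ger (h x)).
have limE (c : R) x : limn (fun n => (c * hn n x)%:E) = (c * h x)%:E.
  apply/cvg_lim => //; apply: cvg_near_cst.
  by apply: filterS (hn_cvg x) => n ->.
have r0 x : 0 <= rate x by rewrite fine_ge0.
have mr := measurable_rate.
have -> : (\int[mu]_x (rate x * h x)%:E
         = limn (fun n => \int[mu]_x (rate x * hn n x)%:E))%E.
  rewrite -monotone_convergence//.
  - by apply: eq_integral => x _; rewrite limE.
  - by move=> n; apply/measurable_EFinP; exact: measurable_funM.
  - by move=> n x _; rewrite lee_fin mulr_ge0.
  - by move=> x _ m n mn; rewrite lee_fin ler_wpM2l// hn_nd.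
have Klim x : (\int[q x]_y (h y)%:E = limn (fun n => \int[q x]_y (hn n y)%:E))%E.
  rewrite -monotone_convergence//.
  - apply: eq_integral => y _; rewrite -[in LHS](mul1r (h y)) -limE.
    by congr (lim _); under eq_fun do rewrite mul1r.
  - by move=> n; exact/measurable_EFinP.
  - by move=> n y _; rewrite lee_fin.
  - by move=> y _ m n mn; rewrite lee_fin hn_nd.
under eq_integral do rewrite Klim.
rewrite monotone_convergence//.
- apply: (f_equal (fun g : nat -> \bar R => limn g)); apply/funext => n.
  apply: (@invariance_bounded _ n%:R) => // x.
  by rewrite hn0 /hn ge_min lexx orbT.
- by move=> n; exact: measurable_kernel_integral.
- by move=> n x _; apply: integral_ge0 => y _; rewrite lee_fin.
- move=> x _ m n mn; apply: ge0_le_integral => //.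
  + by move=> y _; rewrite lee_fin.
  + exact/measurable_EFinP.
  + exact/measurable_EFinP.
  + by move=> y _; rewrite lee_fin hn_nd.
Unshelve. all: by end_near.
Qed.

Lemma kernel_integral_nonneg h : (forall x, 0 <= h x) ->
  mu.-integrable [set: S] (EFin \o h) ->
  [/\ {ae mu, forall x, (q x).-integrable [set: S] (EFin \o h)},
      mu.-integrable [set: S] (EFin \o (fun x => \int[q x]_y h y))
    & \int[mu]_x \int[q x]_y h y = \int[mu]_x (rate x * h x)].
Proof.
move=> h0 /[dup] /integrableP[/measurable_EFinP mh _] ih.
have irh := integrable_rate_mul ih.
pose G x := (\int[q x]_y (h y)%:E)%E.
have mG : measurable_fun [set: S] G := measurable_kernel_integral mh.
have G0 x : (0 <= G x)%E by apply: integral_ge0 => y _; rewrite lee_fin.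
have GE : (\int[mu]_x G x = (\int[mu]_x (rate x * h x))%:E)%E.
  by rewrite invariance_nonneg// EFin_Rintegral.
have iG : mu.-integrable [set: S] G.
  apply/integrableP; split => //.
  by under eq_integral do rewrite gee0_abs//; rewrite GE ltry.
have Gfin : {ae mu, forall x, G x \is a fin_num}.
  by apply: filterS (integrable_ae measurableT iG) => x; exact.
have aeG : G = EFin \o (fun x => \int[q x]_y h y) %[ae mu].
  by apply: filterS Gfin => x Gx _; rewrite /= /Rintegral fineK.
have mI : measurable_fun [set: S] (fun x => \int[q x]_y h y).
  exact: measurableT_comp.
have iI : mu.-integrable [set: S] (EFin \o (fun x => \int[q x]_y h y)).
  apply: le_integrable iG => //; first exact/measurable_EFinP.
  move=> x _; rewrite /= [leRHS]gee0_abs// ger0_norm; last exact: Rintegral_ge0.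
  rewrite /Rintegral -/(G x); have := G0 x.
  by case: (G x) => [r|//|//] _ /=; rewrite ?lexx ?leey.
split=> //.
- apply: filterS Gfin => x; rewrite /G -integral_fin_num_abs// => Gx.
  by apply/integrableP; split => //; exact/measurable_EFinP.
- apply: EFin_inj; rewrite -GE EFin_Rintegral//; apply/esym.
  by apply: ae_eq_integral => //; exact/measurable_EFinP.
Qed.

(** The decomposition [u = |u| - (|u| - u)] reduces integrable functions to
    nonnegative ones. *)
Lemma kernel_integral u : mu.-integrable [set: S] (EFin \o u) ->
  [/\ {ae mu, forall x, (q x).-integrable [set: S] (EFin \o u)},
      mu.-integrable [set: S] (EFin \o (fun x => \int[q x]_y u y))
    & \int[mu]_x \int[q x]_y u y = \int[mu]_x (rate x * u x)].
Proof.
move=> /[dup] /integrableP[/measurable_EFinP mu_ _] iu.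
pose v x := `|u x|; pose w x := `|u x| - u x.
have iv : mu.-integrable [set: S] (EFin \o v) by exact: integrable_norm.
have iw : mu.-integrable [set: S] (EFin \o w).
  by apply: RintegrableD => //; have := RintegrableZ (- 1) iu;
    under [EFin \o _]eq_fun do rewrite /= mulN1r.
have v0 x : 0 <= v x by exact: normr_ge0.
have w0 x : 0 <= w x by rewrite subr_ge0 ler_norm.
have [aev iKv Ev] := kernel_integral_nonneg v0 iv.
have [aew iKw Ew] := kernel_integral_nonneg w0 iw.
have uE x : u x = v x - w x by rewrite /v /w; ring.
have aeu : {ae mu, forall x, (q x).-integrable [set: S] (EFin \o u)}.
  apply: filterS aev => x ivx; apply: ae_integrable_le ivx => //.
  exact: aeW.
have aeK : (fun x => \int[q x]_y u y)
         = (fun x => \int[q x]_y v y - \int[q x]_y w y) %[ae mu].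
  apply: filterS2 aev aew => x ivx iwx _.
  by rewrite -RintegralB//; apply: eq_Rintegral => y _.
have iKvw : mu.-integrable [set: S]
    (EFin \o (fun x => \int[q x]_y v y - \int[q x]_y w y)).
  by apply: RintegrableD => //; have := RintegrableZ (- 1) iKw;
    under [EFin \o _]eq_fun do rewrite /= mulN1r.
have mK : measurable_fun [set: S] (fun x => \int[q x]_y u y).
  by apply: measurableT_comp => //; exact: measurable_kernel_integral.
split => //.
- apply: ae_integrable_le (integrable_norm iKvw) => //.
  by apply: filterS aeK => x /(_ I) ->.
- rewrite (ae_eq_Rintegral _ _ aeK)//; last first.
    by apply/measurable_EFinP; case/integrableP: iKvw.
  rewrite RintegralB// Ev Ew -RintegralB//; [|exact: integrable_rate_mul..].
  by apply: eq_Rintegral => x _; rewrite -mulrBr -uE.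
Qed.

Lemma real_generator_ae u : mu.-integrable [set: S] (EFin \o u) ->
  real_generator u = (fun x => \int[q x]_y u y - rate x * u x) %[ae mu].
Proof.
move=> /[dup] /integrableP[/measurable_EFinP mu_ _] iu.
have [aeu _ _] := kernel_integral iu; apply: filterS aeu => x iux _.
by rewrite real_generatorE// ifT//; case/integrableP: iux.
Qed.

Lemma Rintegral_real_generator u : mu.-integrable [set: S] (EFin \o u) ->
  \int[mu]_x real_generator u x = 0.
Proof.
move=> /[dup] /integrableP[/measurable_EFinP mu_ _] iu.
have [_ iK EK] := kernel_integral iu.
have iru := integrable_rate_mul iu.
rewrite (ae_eq_Rintegral _ _ (real_generator_ae iu)).
- by rewrite RintegralB// EK subrr.
- exact: measurable_real_generator.
- apply: measurable_funB; last by apply: measurable_funM => //; exact: measurable_rate.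
  by apply: measurableT_comp => //; exact: measurable_kernel_integral.
Qed.

Lemma real_generator_linear (a : R) u v :
  mu.-integrable [set: S] (EFin \o u) -> mu.-integrable [set: S] (EFin \o v) ->
  real_generator (fun x => a * u x + v x)
    = (fun x => a * real_generator u x + real_generator v x) %[ae mu].
Proof.
move=> iu iv.
have iauv := RintegrableD (RintegrableZ a iu) iv.
have [aeu _ _] := kernel_integral iu; have [aev _ _] := kernel_integral iv.
apply: filterS2 (filterI aeu aev) (filterI (real_generator_ae iauv)
  (filterI (real_generator_ae iu) (real_generator_ae iv))).
move=> x [iux ivx] [/(_ I) -> [/(_ I) -> /(_ I) ->]] _.
rewrite RintegralD//; last exact: RintegrableZ.
by rewrite RintegralZl//; ring.
Qed.

(** Integrating the pointwise variance bound, the terms in [u ^+ 2] cancel by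
    stationarity. The second estimate gives boundedness, the last one is the
    dissipation bound. *)
Lemma sqint_real_generator u : sqint mu u ->
  [/\ sqint mu (real_generator u),
      rdot mu (real_generator u) (real_generator u) <= (2 * Q) ^+ 2 * rdot mu u u
    & rdot mu (real_generator u) (real_generator u)
        <= - (2 * Q) * rdot mu u (real_generator u)].
Proof.
move=> Hu; have [mu_ iu2] := Hu.
pose L := real_generator u; pose K x := \int[q x]_y (u y ^+ 2).
have mL : measurable_fun [set: S] L := measurable_real_generator mu_.
have [aeu2 iK EK] := kernel_integral iu2.
have iru := integrable_rate_mul iu2.
have var : {ae mu, forall x,
    L x ^+ 2 <= Q * (K x - rate x * u x ^+ 2 - 2 * u x * L x)}.
  apply: filterS2 aeu2 q_le => x iux qx.
  by apply: Rintegral_sub_sqr_le => //; split.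
pose D x := K x - rate x * u x ^+ 2.
have iD : mu.-integrable [set: S] (EFin \o D).
  by apply: RintegrableD => //; have := RintegrableZ (- 1) iru;
    under [EFin \o _]eq_fun do rewrite /= mulN1r.
have D0 : \int[mu]_x D x = 0 by rewrite RintegralB// EK subrr.
have var' : {ae mu, forall x, L x ^+ 2 <= 2 * Q * D x + (2 * Q) ^+ 2 * u x ^+ 2}.
  apply: filterS var => x; rewrite -/(D x).
  (* completing the square absorbs the cross term into half of [L x ^+ 2] *)
  have := sqr_ge0 (L x + 2 * Q * u x).
  set t := L x; set p := D x; set s := u x; lra.
have ib := RintegrableD (RintegrableZ (2 * Q) iD) (RintegrableZ ((2 * Q) ^+ 2) iu2).
have iL2 : mu.-integrable [set: S] (EFin \o (fun x => L x ^+ 2)).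
  apply: ae_integrable_le ib; first exact: measurable_funX.
  by apply: filterS var' => x; rewrite ger0_norm// sqr_ge0.
have HL : sqint mu L by split.
have sqE v : rdot mu v v = \int[mu]_x (v x ^+ 2).
  by apply: eq_Rintegral => x _; rewrite expr2.
split => //; rewrite !sqE.
- apply: le_trans (ae_le_Rintegral iL2 ib var') _.
  rewrite RintegralD//; [|exact: RintegrableZ..].
  by rewrite !RintegralZl// D0 mulr0 add0r.
- have iuL := sqint_mul Hu HL.
  have ib2 := RintegrableD (RintegrableZ Q iD) (RintegrableZ (- (2 * Q)) iuL).
  have var2 : {ae mu, forall x, L x ^+ 2 <= Q * D x + - (2 * Q) * (u x * L x)}.
    apply: filterS var => x.
    have -> : Q * D x + - (2 * Q) * (u x * L x)
        = Q * (K x - rate x * u x ^+ 2 - 2 * u x * L x) by rewrite /D; ring.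
    by [].
  apply: le_trans (ae_le_Rintegral iL2 ib2 var2) _.
  rewrite RintegralD//; [|exact: RintegrableZ..].
  by rewrite !RintegralZl// D0 mulr0 add0r.
Qed.

End RealGenerator.

(** * Complex square-integrable functions *)

Section ReIm.
Variable R : realType.
Implicit Types z w c : R[i].

Lemma Re_add z w : complex.Re (z + w) = complex.Re z + complex.Re w.
Proof. by case: z; case: w. Qed.

Lemma Im_add z w : complex.Im (z + w) = complex.Im z + complex.Im w.
Proof. by case: z; case: w. Qed.

Lemma Re_sub z w : complex.Re (z - w) = complex.Re z - complex.Re w.
Proof. by case: z; case: w. Qed.

Lemma Im_sub z w : complex.Im (z - w) = complex.Im z - complex.Im w.
Proof. by case: z; case: w. Qed.

Lemma Re_mul z w : complex.Re (z * w) =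
  complex.Re z * complex.Re w - complex.Im z * complex.Im w.
Proof. by case: z; case: w. Qed.

Lemma Im_mul z w : complex.Im (z * w) =
  complex.Re z * complex.Im w + complex.Im z * complex.Re w.
Proof. by case: z; case: w. Qed.

Lemma Re_real (a : R) : complex.Re (a%:C)%C = a. Proof. by []. Qed.

Lemma Im_real (a : R) : complex.Im (a%:C)%C = 0. Proof. by []. Qed.

Lemma Re_conjc z : complex.Re (conjc z) = complex.Re z. Proof. by case: z. Qed.

Lemma Im_conjc z : complex.Im (conjc z) = - complex.Im z. Proof. by case: z. Qed.

Lemma Re_scale (a : R) (z : Rcomplex R) : complex.Re (a *: z) = a * complex.Re z.
Proof. by case: z. Qed.

Lemma Im_scale (a : R) (z : Rcomplex R) : complex.Im (a *: z) = a * complex.Im z.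
Proof. by case: z. Qed.

Lemma eq_Complex z w : complex.Re z = complex.Re w ->
  complex.Im z = complex.Im w -> z = w.
Proof. by case: z; case: w => ? ? ? ? /= -> ->. Qed.

End ReIm.

Section ComplexL2Theory.
Context {d : measure_display} {T : measurableType d} {R : realType}.
Variable mu : probability T R.
Implicit Types (f g h : T -> R[i]) (c : R[i]).

Let re f x := complex.Re (f x).
Let im f x := complex.Im (f x).

Lemma Lnorm_normc f :
  Lnorm mu 2%:E (fun x => (Normc.normc (f x))%:E) =
  ((\int[mu]_x (re f x ^+ 2 + im f x ^+ 2)%:E) `^ 2^-1)%E.
Proof.
rewrite unlock; congr (_ `^ _)%E; apply: eq_integral => x _.
rewrite /re /im; case: (f x) => a b /=.
have ab0 : 0 <= a ^+ 2 + b ^+ 2 by rewrite addr_ge0 ?sqr_ge0.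
by rewrite powR_mulrn ?normr_ge0// ger0_norm ?sqrtr_ge0// sqr_sqrtr.
Qed.

Lemma L2P f : L2 mu f <-> sqint mu (re f) /\ sqint mu (im f).
Proof.
rewrite /L2/= /cmeasurable /finite_norm Lnorm_normc; split.
- move=> [[mr mi] foo].
  have {}foo : (\int[mu]_x (re f x ^+ 2 + im f x ^+ 2)%:E < +oo)%E.
    by apply: lty_poweRy foo; rewrite invr_eq0.
  have i2 : mu.-integrable [set: T] (EFin \o (fun x => re f x ^+ 2 + im f x ^+ 2)).
    apply/integrableP; split.
      by apply/measurable_EFinP/measurable_funD; exact: measurable_funX.
    under eq_integral do rewrite /= ger0_norm ?addr_ge0 ?sqr_ge0//.
    exact: foo.
  split; split => //; apply: ae_integrable_le i2; try exact: measurable_funX.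
  + by apply/aeW => x; rewrite ger0_norm ?sqr_ge0// lerDl sqr_ge0.
  + by apply/aeW => x; rewrite ger0_norm ?sqr_ge0// lerDr sqr_ge0.
- move=> [[mr ir] [mi ii]]; split=> //; apply: poweR_lty.
  have /integrableP[_] := RintegrableD ir ii.
  by under eq_integral do rewrite /= ger0_norm ?addr_ge0 ?sqr_ge0//.
Qed.

(** The real part of the inner product. It makes complex functions a real
    pre-Hilbert space, with the real scalar multiplication that [Rcomplex R]
    carries. *)
Definition cdot f g : R :=
  rdot mu (fun x => complex.Re (f x)) (fun x => complex.Re (g x))
  + rdot mu (fun x => complex.Im (f x)) (fun x => complex.Im (g x)).

Lemma L2normE f : L2 mu f -> L2norm mu f = Num.sqrt (cdot f f).
Proof.
move=> /L2P[Hr Hi]; rewrite /L2norm Lnorm_normc fine_poweR powR12_sqrt; last first.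
  by apply: Rintegral_ge0 => x _; rewrite addr_ge0 ?sqr_ge0.
congr Num.sqrt; rewrite -[LHS]/(\int[mu]_x (re f x ^+ 2 + im f x ^+ 2)).
by have [_ ir] := Hr; have [_ ii] := Hi; rewrite RintegralD.
Qed.

Lemma L2_linear c f g : L2 mu f -> L2 mu g -> L2 mu (fun x => c * f x + g x).
Proof.
move=> /L2P[Hfr Hfi] /L2P[Hgr Hgi]; apply/L2P; split.
- have -> : re (fun x => c * f x + g x) = fun x =>
      complex.Re c * re f x + (- complex.Im c * im f x + re g x).
    by apply/funext => x; rewrite /re Re_add Re_mul /im; ring.
  by apply: sqint_linear => //; exact: sqint_linear.
- have -> : im (fun x => c * f x + g x) = fun x =>
      complex.Re c * im f x + (complex.Im c * re f x + im g x).
    by apply/funext => x; rewrite /im Im_add Im_mul /re; ring.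
  by apply: sqint_linear => //; exact: sqint_linear.
Qed.

Lemma L2_cst c : L2 mu (cst c).
Proof. by apply/L2P; split; apply: sqint_cst; exact: probability_lty. Qed.

Lemma L2_prehilbert : prehilbert (L2 mu : set (T -> Rcomplex R)) cdot.
Proof.
have P := rdot_prehilbert mu.
have reL a (f g : T -> Rcomplex R) :
    re (a *: f + g) = (a *: (re f : T -> R^o) + re g).
  by apply/funext => x; rewrite /re Re_add Re_scale.
have imL a (f g : T -> Rcomplex R) :
    im (a *: f + g) = (a *: (im f : T -> R^o) + im g).
  by apply/funext => x; rewrite /im Im_add Im_scale.
split.
- move=> a f g /L2P[? ?] /L2P[? ?]; apply/L2P.
  by rewrite reL imL; split; exact: (preh_closed P).
- move=> f g /L2P[? ?] /L2P[? ?].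
  by rewrite /cdot; congr (_ + _); exact: (preh_sym P).
- move=> a f g h /L2P[? ?] /L2P[? ?] /L2P[? ?].
  rewrite /cdot -![fun x => complex.Re _]/(re _) -![fun x => complex.Im _]/(im _).
  by rewrite reL imL !(preh_linear P)//; ring.
- by move=> f /L2P[? ?]; rewrite addr_ge0// (preh_ge0 P).
Qed.

Lemma L2_complete : cauchy_complete (L2 mu : set (T -> Rcomplex R)) cdot.
Proof.
have P := rdot_prehilbert mu.
have reB (f g : T -> Rcomplex R) : re (f - g) = (re f : T -> R^o) - re g.
  by apply/funext => x; rewrite /re Re_sub.
have imB (f g : T -> Rcomplex R) : im (f - g) = (im f : T -> R^o) - im g.
  by apply/funext => x; rewrite /im Im_sub.
have cdotB (f g : T -> Rcomplex R) : cdot (f - g) (f - g) =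
    rdot mu ((re f : T -> R^o) - re g) ((re f : T -> R^o) - re g)
    + rdot mu ((im f : T -> R^o) - im g) ((im f : T -> R^o) - im g).
  by rewrite -reB -imB.
move=> u Hu uC.
have Hr n : sqint mu (re (u n)) by have /L2P[] := Hu n.
have Hi n : sqint mu (im (u n)) by have /L2P[] := Hu n.
have [|r Hl rl] := @sqint_complete _ _ _ mu (fun n => re (u n)) Hr.
  move=> e /uC[N NP]; exists N => m n /NP + /[dup] => /[apply].
  move=> + _; rewrite cdotB; apply: le_lt_trans; rewrite lerDl.
  by apply: (preh_ge0 P); exact: (prehB P).
have [|s Hs sl] := @sqint_complete _ _ _ mu (fun n => im (u n)) Hi.
  move=> e /uC[N NP]; exists N => m n /NP + /[dup] => /[apply].
  move=> + _; rewrite cdotB; apply: le_lt_trans; rewrite lerDr.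
  by apply: (preh_ge0 P); exact: (prehB P).
exists (fun x => Complex (r x) (s x)); first by apply/L2P.
move=> e e0; have e20 : 0 < e / 2 by rewrite divr_gt0.
have [N1 h1] := rl _ e20; have [N2 h2] := sl _ e20.
exists (maxn N1 N2) => n; rewrite geq_max => /andP[/h1 {}h1 /h2 {}h2].
by rewrite cdotB (splitr e); exact: ltrD.
Qed.

Lemma cdot_null f : L2 mu f -> cdot f f = 0 -> f = cst 0 %[ae mu].
Proof.
move=> /L2P[Hr Hi] /eqP; have P := rdot_prehilbert mu.
rewrite paddr_eq0 ?(preh_ge0 P)// => /andP[/eqP r0 /eqP i0].
apply: filterS2 (rdot_null Hr r0) (rdot_null Hi i0) => x + + _.
by move=> /(_ I) re0 /(_ I) im0; exact: eq_Complex.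
Qed.

Definition cintegrable f := mu.-integrable [set: T] (EFin \o re f) /\
  mu.-integrable [set: T] (EFin \o im f).

Lemma cintegral_linear c f g : cintegrable f -> cintegrable g ->
  cintegral mu (fun x => c * f x + g x) = c * cintegral mu f + cintegral mu g.
Proof.
move=> [fr fi] [gr gi]; apply: eq_Complex.
- rewrite Re_add Re_mul /=.
  under eq_Rintegral do rewrite Re_add Re_mul -mulNr -addrA.
  rewrite !RintegralD ?RintegralZl//; try exact: RintegrableZ.
    by rewrite /re /im; ring.
  by apply: RintegrableD => //; exact: RintegrableZ.
- rewrite Im_add Im_mul /=.
  under eq_Rintegral do rewrite Im_add Im_mul -addrA.
  rewrite !RintegralD ?RintegralZl//; try exact: RintegrableZ.
    by rewrite /re /im; ring.
  by apply: RintegrableD => //; exact: RintegrableZ.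
Qed.

Lemma L2_cintegrable f : L2 mu f -> cintegrable f.
Proof.
by move=> /L2P[Hr Hi]; split; apply: sqint_integrable => //; exact: probability_lty.
Qed.

Lemma cintegrable_inner f g : L2 mu f -> L2 mu g ->
  cintegrable (fun x => conjc (f x) * g x).
Proof.
move=> /L2P[Hfr Hfi] /L2P[Hgr Hgi]; split.
- have := RintegrableD (sqint_mul Hfr Hgr) (sqint_mul Hfi Hgi).
  congr (mu.-integrable _ _); apply/funext => x; congr EFin.
  by rewrite /re /im Re_mul Re_conjc Im_conjc; ring.
- have := RintegrableD (sqint_mul Hfr Hgi) (RintegrableZ (- 1) (sqint_mul Hfi Hgr)).
  congr (mu.-integrable _ _); apply/funext => x; congr EFin.
  by rewrite /re /im Im_mul Re_conjc Im_conjc; ring.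
Qed.

Lemma Re_inner f g : L2 mu f -> L2 mu g -> complex.Re (inner mu f g) = cdot f g.
Proof.
move=> /L2P[Hfr Hfi] /L2P[Hgr Hgi]; rewrite /inner /cdot /rdot /=.
rewrite -RintegralD//; [|exact: sqint_mul..].
by apply: eq_Rintegral => x _; rewrite Re_mul Re_conjc Im_conjc; ring.
Qed.

Lemma inner_linear c f g h : L2 mu f -> L2 mu g -> L2 mu h ->
  inner mu f (fun x => c * g x + h x) = c * inner mu f g + inner mu f h.
Proof.
move=> Hf Hg Hh; rewrite /inner -cintegral_linear; [|exact: cintegrable_inner..].
by congr cintegral; apply/funext => x; rewrite mulrDr mulrCA.
Qed.

Lemma inner_conj f g : L2 mu f -> L2 mu g ->
  inner mu g f = conjc (inner mu f g).
Proof.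
move=> Hf Hg; have [_ ifg] := cintegrable_inner Hf Hg.
apply: eq_Complex; rewrite ?Re_conjc ?Im_conjc /=.
- by apply: eq_Rintegral => x _; rewrite !Re_mul !Re_conjc !Im_conjc; ring.
- rewrite -mulN1r -RintegralZl//; apply: eq_Rintegral => x _.
  by rewrite !Im_mul !Re_conjc !Im_conjc; ring.
Qed.

Lemma inner_ae f g g' : L2 mu f -> L2 mu g -> L2 mu g' ->
  g = g' %[ae mu] -> inner mu f g = inner mu f g'.
Proof.
move=> Hf Hg Hg' gg'.
have mI k : L2 mu k -> measurable_fun [set: T] (re (fun x => conjc (f x) * k x)) /\
    measurable_fun [set: T] (im (fun x => conjc (f x) * k x)).
  move=> Hk; have [/integrableP[mr _] /integrableP[mi _]] := cintegrable_inner Hf Hk.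
  by split; exact/measurable_EFinP.
have [mr mi] := mI _ Hg; have [mr' mi'] := mI _ Hg'.
apply: eq_Complex; apply: ae_eq_Rintegral => //;
  by apply: filterS gg' => x /[apply] ->.
Qed.

Lemma inner_cst1 f : inner mu (cst 1) f = cintegral mu f.
Proof.
by congr cintegral; apply/funext => x; rewrite /cst rmorph1 mul1r.
Qed.

Lemma L2_0_linear c f g : L2_0 mu f -> L2_0 mu g ->
  L2_0 mu (fun x => c * f x + g x).
Proof.
move=> [Hf f0] [Hg g0]; split; first exact: L2_linear.
rewrite cintegral_linear; [|exact: L2_cintegrable..].
by rewrite f0 g0 mulr0 addr0.
Qed.

Lemma scale_real (a : R) f g :
  (a *: (f : T -> Rcomplex R) + g) = fun x => (a%:C)%C * f x + g x.
Proof.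
apply/funext => x; apply: eq_Complex.
  by rewrite !Re_add Re_scale Re_mul Re_real Im_real mul0r subr0.
by rewrite !Im_add Im_scale Im_mul Re_real Im_real mul0r addr0.
Qed.

Lemma L2_0_prehilbert : prehilbert (L2_0 mu : set (T -> Rcomplex R)) cdot.
Proof.
have P := L2_prehilbert; split.
- by move=> a f g Hf Hg; rewrite scale_real; exact: L2_0_linear.
- by move=> f g [? _] [? _]; exact: (preh_sym P).
- by move=> a f g h [? _] [? _] [? _]; exact: (preh_linear P).
- by move=> f [? _]; exact: (preh_ge0 P).
Qed.

(** The mean is continuous for the L^2 norm, as [mu] is finite. *)
Lemma L2_0_complete : cauchy_complete (L2_0 mu : set (T -> Rcomplex R)) cdot.
Proof.
have P := L2_prehilbert; have H1 := L2_cst 1.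
move=> u Hu uC; have Hu' n : L2 mu (u n) := (Hu n).1.
have [l Hl ul] := L2_complete Hu' uC; exists l => //; split=> //.
have mean_bound n : (complex.Re (cintegral mu l)) ^+ 2 <= cdot (u n - l) (u n - l)
    /\ (complex.Im (cintegral mu l)) ^+ 2 <= cdot (u n - l) (u n - l).
  have Hul : L2 mu (u n - l) by exact: (prehB P).
  have /L2P[Hr Hi] := Hul.
  have E : cintegral mu l = - cintegral mu (u n - l).
    have -> : u n - l = fun x => (- 1) * l x + u n x.
      by apply/funext => x; rewrite mulN1r addrC.
    rewrite cintegral_linear; [|exact: L2_cintegrable..].
    by rewrite (Hu n).2 addr0 mulN1r opprK.
  have Q := rdot_prehilbert mu.
  rewrite E !raddfN/= !sqrrN; split.
  - apply: le_trans (Rintegral_sqr_le (probability_lty mu) Hr) _.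
    by rewrite [X in fine X](probability_setT mu) mul1r lerDl (preh_ge0 Q).
  - apply: le_trans (Rintegral_sqr_le (probability_lty mu) Hi) _.
    by rewrite [X in fine X](probability_setT mu) mul1r lerDr (preh_ge0 Q).
have le0 (t : R) : (forall n, t ^+ 2 <= cdot (u n - l) (u n - l)) -> t = 0.
  move=> ht; apply/eqP; rewrite -sqrf_eq0 eq_le sqr_ge0 andbT.
  apply/ler_addgt0Pr => e /ul[N /(_ N (leqnn _))]; rewrite add0r => ule.
  exact: le_trans (ht N) (ltW ule).
by apply: eq_Complex; apply: le0 => n; case: (mean_bound n).
Qed.

End ComplexL2Theory.

(** * Adjoints and symmetrization of bounded operators *)

Section Adjoint.
Context {d : measure_display} {T : measurableType d} {R : realType}.
Variable mu : probability T R.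
Implicit Types (f g h : T -> R[i]) (c : R[i]) (V : set (T -> R[i])).
Implicit Types A : (T -> R[i]) -> T -> R[i].

Lemma L2norm_le f g (K : R) : L2 mu f -> L2 mu g -> 0 <= K ->
  cdot mu f f <= K ^+ 2 * cdot mu g g -> L2norm mu f <= K * L2norm mu g.
Proof.
move=> Hf Hg K0 fg; rewrite !L2normE// -(ger0_norm K0) -sqrtr_sqr -sqrtrM ?sqr_ge0//.
exact: ler_wsqrtr.
Qed.

Lemma L2norm_le_sqr f g (K : R) : L2 mu f -> L2 mu g ->
  L2norm mu f <= K * L2norm mu g -> cdot mu f f <= K ^+ 2 * cdot mu g g.
Proof.
move=> Hf Hg; have P := L2_prehilbert mu.
have f0 := preh_ge0 P Hf; have g0 := preh_ge0 P Hg.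
rewrite !L2normE// => fg.
have := lerXn2r 2 _ _ fg; rewrite exprMn !sqr_sqrtr//; apply; rewrite nnegrE ?sqrtr_ge0//.
exact: le_trans (sqrtr_ge0 _) fg.
Qed.

Lemma operator_inner_linear V A c f g h : V `<=` L2 mu ->
  bounded_operator mu V A -> (forall c f g, V f -> V g -> V (fun x => c * f x + g x)) ->
  L2 mu f -> V g -> V h ->
  inner mu f (A (fun x => c * g x + h x)) = c * inner mu f (A g) + inner mu f (A h).
Proof.
move=> VL2 [VA linA _] Vlin Hf Vg Vh; rewrite -inner_linear//; try exact/VL2/VA.
apply: inner_ae => //; first exact/VL2/VA/Vlin.
  by apply: L2_linear; exact/VL2/VA.
exact: linA.
Qed.

Lemma operator_bound V A : V `<=` L2 mu -> bounded_operator mu V A ->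
  exists M, forall f, V f -> cdot mu (A f) (A f) <= M ^+ 2 * cdot mu f f.
Proof.
move=> VL2 [VA _ [M AM]]; exists M => f Vf.
by apply: L2norm_le_sqr (AM _ Vf); apply: VL2 => //; exact: VA.
Qed.

Lemma inner_ext f g : L2 mu f -> L2 mu g ->
  (forall h, L2 mu h -> inner mu h f = inner mu h g) -> f = g %[ae mu].
Proof.
move=> Hf Hg fg; pose w x := (- 1) * g x + f x.
have Hw : L2 mu w by exact: L2_linear.
have : cdot mu w w = 0.
  by rewrite -Re_inner// inner_linear// fg// mulN1r addNr.
move/(cdot_null Hw); apply: filterS => x /[apply] /eqP.
by rewrite /w mulN1r addrC subr_eq0 => /eqP.
Qed.

(** The Riesz representation of the real part determines the complex
    functional, since its imaginary part at [h] is its real part at a multiple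
    of [h]. *)
Lemma adjointP A f : bounded_operator mu (L2 mu) A -> L2 mu f ->
  L2 mu (adjoint mu A f) /\
  forall h, L2 mu h -> inner mu (adjoint mu A f) h = inner mu f (A h).
Proof.
move=> boA Hf; have P := L2_prehilbert mu.
have [LA _ _] := boA; have [M AM] := operator_bound (@subset_refl _ _) boA.
have linA c g h : L2 mu g -> L2 mu h -> inner mu f (A (fun x => c * g x + h x))
    = c * inner mu f (A g) + inner mu f (A h).
  move=> Hg Hh; apply: (operator_inner_linear _ (@subset_refl _ _) boA) => //.
  by move=> *; exact: L2_linear.
suff /xgetPex : exists g, L2 mu g /\
    forall h, L2 mu h -> inner mu g h = inner mu f (A h) by exact.
have [g Hg gP] : exists2 g, L2 mu g & forall h, L2 mu h -> cdot mu f (A h) = cdot mu g h.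
  apply: (@riesz_representation _ _ (L2 mu : set (T -> Rcomplex R)) (cdot mu) P
    (fun h => cdot mu f (A h)) (cdot mu f f * M ^+ 2) (@L2_complete _ _ _ mu)).
  - by exists f.
  - move=> a g h Hg Hh; have Hgh := preh_closed P a Hg Hh.
    rewrite -!Re_inner//; try exact: LA.
    by rewrite scale_real linA// Re_add Re_mul Re_real Im_real mul0r subr0.
  - move=> h Hh; apply: le_trans (form_cauchy_schwarz P Hf (LA _ Hh)) _.
    by rewrite -mulrA ler_wpM2l ?(preh_ge0 P)// AM.
have reP h : L2 mu h -> complex.Re (inner mu g h) = complex.Re (inner mu f (A h)).
  by move=> Hh; rewrite !Re_inner// ?gP//; exact: LA.
exists g; split=> // h Hh; apply: eq_Complex; first exact: reP.
have [Re_i Im_i] : complex.Re ('i%C : R[i]) = 0 /\ complex.Im ('i%C : R[i]) = 1 by [].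
have := reP _ (L2_linear 'i%C Hh Hh).
rewrite linA// inner_linear// !Re_add !Re_mul Re_i Im_i (reP h)// => /addIr.
by rewrite !mul0r !mul1r !sub0r => /oppr_inj.
Qed.

Lemma adjoint_innerr A f h : bounded_operator mu (L2 mu) A ->
  L2 mu f -> L2 mu h -> inner mu h (adjoint mu A f) = inner mu (A h) f.
Proof.
move=> boA Hf Hh; have [Hg gP] := adjointP boA Hf; have [LA _ _] := boA.
by rewrite inner_conj// gP// -inner_conj//; exact: LA.
Qed.

(** [||A^* f|| ^ 2 = <f, A A^* f> <= ||f|| ||A|| ||A^* f||]. *)
Lemma adjoint_bound A (M : R) : bounded_operator mu (L2 mu) A ->
  (forall f, L2 mu f -> cdot mu (A f) (A f) <= M ^+ 2 * cdot mu f f) ->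
  forall f, L2 mu f ->
    cdot mu (adjoint mu A f) (adjoint mu A f) <= M ^+ 2 * cdot mu f f.
Proof.
move=> boA AM f Hf; have P := L2_prehilbert mu; have [LA _ _] := boA.
have [Hg gP] := adjointP boA Hf; set g := adjoint mu A f in Hg gP *.
have ggE : cdot mu g g = cdot mu f (A g).
  by rewrite -!Re_inner//; [rewrite gP|exact: LA].
have g0 := preh_ge0 P Hg; have f0 := preh_ge0 P Hf.
have := form_cauchy_schwarz P Hf (LA _ Hg); rewrite -ggE.
have [->|gn0] := eqVneq (cdot mu g g) 0; first by rewrite mulr_ge0// sqr_ge0.
have g_gt0 : 0 < cdot mu g g by rewrite lt_def gn0.
move=> h; rewrite -(ler_pM2r g_gt0) -expr2; apply: le_trans h _.
by rewrite mulrAC [leRHS]mulrC ler_wpM2l// AM.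
Qed.

(** The null term puts both summands in the shape [c * g x + h x] in which
    linearity is stated. *)
Lemma symmetrizedE A f : symmetrized mu A f =
  fun x => 2^-1 * A f x + (2^-1 * adjoint mu A f x + cst 0 x).
Proof. by apply/funext => x; rewrite /symmetrized addr0 mulrC mulrDr. Qed.

Lemma inner0r f : L2 mu f -> inner mu f (cst 0) = 0.
Proof.
move=> Hf; have H0 := L2_cst mu (0 : R[i]).
transitivity (inner mu f (fun x => - 1 * cst 0 x + cst 0 x)).
  by congr inner; apply/funext => x; rewrite /cst mulr0 addr0.
by rewrite inner_linear// mulN1r addNr.
Qed.

Lemma L2_symmetrized A f : bounded_operator mu (L2 mu) A -> L2 mu f ->
  L2 mu (symmetrized mu A f).
Proof.
move=> boA Hf; have [LA _ _] := boA; have [Hg _] := adjointP boA Hf.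
rewrite symmetrizedE; apply: L2_linear; first exact: LA.
by apply: L2_linear => //; exact: L2_cst.
Qed.

Lemma inner_symmetrized A f h : bounded_operator mu (L2 mu) A ->
  L2 mu f -> L2 mu h ->
  inner mu h (symmetrized mu A f) = 2^-1 * (inner mu h (A f) + inner mu (A h) f).
Proof.
move=> boA Hf Hh; have [LA _ _] := boA; have [Hg _] := adjointP boA Hf.
have H0 := L2_cst mu (0 : R[i]).
have Hs : L2 mu (fun x => 2^-1 * adjoint mu A f x + cst 0 x) by exact: L2_linear.
rewrite symmetrizedE inner_linear//; last exact: LA.
by rewrite inner_linear// inner0r// addr0 adjoint_innerr// -mulrDr.
Qed.

Lemma symmetrized_bounded A : bounded_operator mu (L2 mu) A ->
  bounded_operator mu (L2 mu) (symmetrized mu A).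
Proof.
move=> boA; have P := L2_prehilbert mu; have [LA _ _] := boA.
have [M AM] := operator_bound (@subset_refl _ _) boA.
split; first by move=> f; exact: L2_symmetrized.
- move=> c f g Hf Hg; have Hfg := L2_linear c Hf Hg.
  have Hs := L2_symmetrized boA.
  apply: inner_ext; [exact: Hs|by apply: L2_linear; exact: Hs|].
  move=> h Hh; have HAh := LA _ Hh.
  rewrite inner_linear//; try exact: Hs.
  rewrite !inner_symmetrized// inner_linear//.
  rewrite (operator_inner_linear _ (@subset_refl _ _) boA)//; first by ring.
  by move=> *; exact: L2_linear.
exists `|M| => f Hf; have Hs := L2_symmetrized boA Hf.
apply: L2norm_le => //; rewrite real_normK ?num_real//.
have [Hg _] := adjointP boA Hf; have HAf := LA _ Hf.
set s := symmetrized mu A f in Hs *; set K := M ^+ 2 * _.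
have s0 := preh_ge0 P Hs.
have sE : cdot mu s s = 2^-1 * (cdot mu s (A f) + cdot mu s (adjoint mu A f)).
  rewrite -!Re_inner// {2}/s inner_symmetrized// -adjoint_innerr//.
  rewrite (_ : 2^-1 = (2^-1%:C)%C); last by rewrite rmorphV/= ?rmorph_nat ?unitfE.
  by rewrite Re_mul Re_real Im_real mul0r subr0 Re_add.
have h1 : cdot mu s (A f) ^+ 2 <= cdot mu s s * K.
  by apply: le_trans (form_cauchy_schwarz P Hs HAf) _; rewrite ler_wpM2l// AM.
have h2 : cdot mu s (adjoint mu A f) ^+ 2 <= cdot mu s s * K.
  by apply: le_trans (form_cauchy_schwarz P Hs Hg) _; rewrite ler_wpM2l// adjoint_bound.
have [->|sn0] := eqVneq (cdot mu s s) 0.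
  by rewrite mulr_ge0 ?sqr_ge0// (preh_ge0 P).
have s_gt0 : 0 < cdot mu s s by rewrite lt_def sn0.
rewrite -(ler_pM2l s_gt0) -expr2.
have -> : cdot mu s s ^+ 2
    = 4^-1 * (cdot mu s (A f) + cdot mu s (adjoint mu A f)) ^+ 2.
  by rewrite sE; field.
move: h1 h2; set m := cdot mu s s * K.
set p := cdot mu s (A f); set r := cdot mu s _ => h1 h2.
have := sqr_ge0 (p - r); lra.
Qed.

Lemma symmetrized_self_adjoint A : bounded_operator mu (L2 mu) A ->
  self_adjoint mu (symmetrized mu A).
Proof.
move=> boA f g Hf Hg; have [LA _ _] := boA.
rewrite inner_symmetrized//.
rewrite [RHS]inner_conj//; last exact: L2_symmetrized.
have conjE (z w : R[i]) : conjc (2^-1 * (z + w)) = 2^-1 * (conjc z + conjc w).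
  by rewrite rmorphM rmorphD rmorphV ?rmorph_nat ?unitfE.
rewrite inner_symmetrized// conjE -!inner_conj//; try exact: LA.
by rewrite addrC.
Qed.

End Adjoint.

(** * The spectrum of a symmetric operator on mean-zero functions *)

Section Spectrum.
Context {d : measure_display} {T : measurableType d} {R : realType}.
Variable mu : probability T R.
Implicit Types (f g h : T -> R[i]) (c : R[i]).

Let sub_L2 : L2_0 mu `<=` L2 mu. Proof. by move=> f []. Qed.
Let P0 := L2_0_prehilbert mu.
Let PL := L2_prehilbert mu.

Lemma cdot_ae f g g' : L2 mu f -> L2 mu g -> L2 mu g' -> g = g' %[ae mu] ->
  cdot mu f g = cdot mu f g'.
Proof.
move=> Hf Hg Hg' gg'; rewrite -!Re_inner//.
by congr complex.Re; exact: inner_ae.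
Qed.

Lemma cdot_ae_eq f g : L2 mu f -> L2 mu g -> f = g %[ae mu] ->
  cdot mu f f = cdot mu g g.
Proof.
move=> Hf Hg fg; rewrite (cdot_ae Hf Hf Hg fg) (preh_sym PL Hf Hg).
exact: cdot_ae.
Qed.

Section Operator.
Variable A : (T -> R[i]) -> T -> R[i].
Hypothesis boA : bounded_operator mu (L2_0 mu) A.
Hypothesis symA : forall f g, L2_0 mu f -> L2_0 mu g ->
  cdot mu f (A g) = cdot mu (A f) g.
Variable r : R.

Let Ar f x := A f x - (r%:C)%C * f x.

Let ArE f : Ar f = fun x => (- (r%:C)%C) * f x + A f x.
Proof. by apply/funext => x; rewrite /Ar mulNr addrC. Qed.

Let Ar_scale f : Ar f = (- r) *: (f : T -> Rcomplex R) + A f.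
Proof. by rewrite scale_real ArE rmorphN. Qed.

Let L0A f : L2_0 mu f -> L2_0 mu (A f). Proof. by case: boA => + _ _; exact. Qed.

Let L0Ar f : L2_0 mu f -> L2_0 mu (Ar f).
Proof. by move=> Hf; rewrite ArE; apply: L2_0_linear => //; exact: L0A. Qed.

Let Ar_linear c f g : L2_0 mu f -> L2_0 mu g ->
  Ar (fun x => c * f x + g x) = (fun x => c * Ar f x + Ar g x) %[ae mu].
Proof.
move=> Hf Hg; have [_ linA _] := boA.
by apply: filterS (linA c _ _ Hf Hg) => x /[apply] E; rewrite /Ar E; ring.
Qed.

Let cdot_Ar f g : L2_0 mu f -> L2_0 mu g ->
  cdot mu f (Ar g) = cdot mu f (A g) - r * cdot mu f g.
Proof.
move=> Hf Hg; rewrite Ar_scale (preh_linear P0)//; last exact: L0A.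
by rewrite mulNr addrC.
Qed.

Let symAr f g : L2_0 mu f -> L2_0 mu g -> cdot mu f (Ar g) = cdot mu (Ar f) g.
Proof.
move=> Hf Hg; rewrite (preh_sym P0 (L0Ar Hf) Hg) !cdot_Ar// symA//.
by rewrite (preh_sym P0 (L0A Hf) Hg) (preh_sym P0 Hf Hg).
Qed.

Let linAr (c : R) f g h : L2_0 mu f -> L2_0 mu g -> L2_0 mu h ->
  cdot mu f (Ar (c *: (g : T -> Rcomplex R) + h))
    = c * cdot mu f (Ar g) + cdot mu f (Ar h).
Proof.
move=> Hf Hg Hh; have HAg := L0Ar Hg; have HAh := L0Ar Hh.
have Hgh : L2_0 mu (fun x => (c%:C)%C * g x + h x) by exact: L2_0_linear.
have HAgh : L2_0 mu (fun x => (c%:C)%C * Ar g x + Ar h x) by exact: L2_0_linear.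
rewrite scale_real (cdot_ae (sub_L2 Hf) (sub_L2 (L0Ar Hgh)) (sub_L2 HAgh)).
  by rewrite -scale_real (preh_linear P0).
exact: Ar_linear.
Qed.

Let boundAr : exists M, forall f, L2_0 mu f ->
  cdot mu (Ar f) (Ar f) <= M ^+ 2 * cdot mu f f.
Proof.
have [M AM] := operator_bound sub_L2 boA.
exists (`|M| + `|r|) => f Hf; have HAf := L0A Hf.
have f0 := preh_ge0 P0 Hf; have A0 := preh_ge0 P0 HAf.
have -> : Ar f = A f + (- r) *: (f : T -> Rcomplex R) by rewrite Ar_scale addrC.
rewrite (formDZ P0)//.
have cs := form_cauchy_schwarz P0 HAf Hf.
have {}AM := AM _ Hf.
have b1 : `|cdot mu (A f) f| <= `|M| * cdot mu f f.
  rewrite -ler_sqr ?nnegrE ?mulr_ge0// real_normK ?num_real//.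
  apply: le_trans cs _; rewrite exprMn real_normK ?num_real// expr2 mulrA.
  by rewrite ler_wpM2r.
have b2 : - r * cdot mu (A f) f <= `|r| * (`|M| * cdot mu f f).
  apply: le_trans (ler_norm _) _; rewrite normrM normrN.
  by rewrite ler_wpM2l.
have -> : (`|M| + `|r|) ^+ 2 * cdot mu f f = `|M| ^+ 2 * cdot mu f f
   + 2 * (`|r| * (`|M| * cdot mu f f)) + `|r| ^+ 2 * cdot mu f f by ring.
rewrite !real_normK ?num_real// sqrrN -mulrA lerD2r; apply: lerD => //.
by rewrite ler_pM2l.
Qed.

(** A coercive symmetric operator is onto. Its inverse is chosen for each
    function among solutions that coercivity makes equal almost everywhere, and
    coercivity also bounds it. *)
Lemma coercive_notin_spectrum (a : R) : 0 < a ->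
  (forall f, L2_0 mu f -> (r + a) * cdot mu f f <= cdot mu f (A f)) ->
  ~ spectrum mu (L2_0 mu) A (r%:C)%C.
Proof.
move=> a0 coerA; apply; rewrite -/Ar.
have coer f : L2_0 mu f -> a * cdot mu f f <= cdot mu f (Ar f).
  by move=> Hf; rewrite cdot_Ar// lerBrDl -mulrDl; exact: coerA.
have inj f : L2_0 mu f -> Ar f = cst 0 %[ae mu] -> f = cst 0 %[ae mu].
  move=> Hf Af0; have f0 := preh_ge0 P0 Hf.
  have := coer _ Hf.
  rewrite (cdot_ae (sub_L2 Hf) (sub_L2 (L0Ar Hf)) (L2_cst mu 0) Af0).
  rewrite -[cst 0]/(0 : T -> Rcomplex R) (form0r P0)// pmulr_rle0// => fle0.
  by apply: (cdot_null (sub_L2 Hf)); apply/eqP; rewrite eq_le fle0.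
have inj2 f g : L2_0 mu f -> L2_0 mu g -> Ar f = Ar g %[ae mu] -> f = g %[ae mu].
  move=> Hf Hg fg; have Hw := L2_0_linear (- 1) Hg Hf.
  have : (fun x => - 1 * g x + f x) = cst 0 %[ae mu].
    apply: inj => //; apply: filterS2 fg (Ar_linear (- 1) Hg Hf) => x + + _.
    by move=> /(_ I) E /(_ I) ->; rewrite E mulN1r addNr.
  apply: filterS => x /[apply] /eqP; rewrite mulN1r addrC subr_eq0.
  by move=> /eqP.
have surj f : L2_0 mu f -> exists g, L2_0 mu g /\ Ar g = f %[ae mu].
  move=> Hf; have [M ArM] := boundAr.
  have [g Hg gP] : exists2 g, L2_0 mu g & forall h, L2_0 mu h ->
      cdot mu (Ar g) h = cdot mu f h.
    apply: (coercive_surjective P0 (A := Ar) (M := `|M|) (@L2_0_complete _ _ _ mu)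
      L0Ar linAr symAr _ a0 coer Hf).
    move=> h Hh; have h0 := preh_ge0 P0 Hh.
    apply: le_trans (ler_norm _) _; rewrite -ler_sqr ?nnegrE ?mulr_ge0//.
    rewrite real_normK ?num_real//.
    apply: le_trans (form_cauchy_schwarz P0 Hh (L0Ar Hh)) _.
    rewrite exprMn real_normK ?num_real// mulrC [_ ^+ 2 in leRHS]expr2 mulrA.
    by rewrite ler_wpM2r// ArM.
  exists g; split=> //; have Hw := L2_0_linear (- 1) Hf (L0Ar Hg).
  have Hw' : L2_0 mu (Ar g - f : T -> Rcomplex R) by exact: (prehB P0 (L0Ar Hg) Hf).
  have : (Ar g - f : T -> Rcomplex R) = cst 0 %[ae mu].
    apply: (cdot_null (sub_L2 Hw')); rewrite (formBl P0)//; [|exact: L0Ar..].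
    by rewrite gP// subrr.
  by apply: filterS => x /[apply] /eqP; rewrite subr_eq0 => /eqP.
pose B f := xget (cst 0) [set g | L2_0 mu g /\ Ar g = f %[ae mu]].
have BP f : L2_0 mu f -> L2_0 mu (B f) /\ Ar (B f) = f %[ae mu].
  by move=> /surj; exact: xgetPex.
have L0B f (Hf : L2_0 mu f) := (BP _ Hf).1.
have ArB f (Hf : L2_0 mu f) := (BP _ Hf).2.
exists B; split.
- split; first exact: L0B.
  + move=> c f g Hf Hg; have Hfg := L2_0_linear c Hf Hg.
    have HBf := L0B _ Hf; have HBg := L0B _ Hg.
    apply: inj2; [exact: L0B|exact: L2_0_linear|].
    apply: filterS2 (filterI (ArB _ Hf) (ArB _ Hg))
      (filterI (ArB _ Hfg) (Ar_linear c HBf HBg)) => x.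
    by move=> [/(_ I) E1 /(_ I) E2] [/(_ I) -> /(_ I) ->]; rewrite E1 E2.
  + exists a^-1 => f Hf; have HBf := L0B _ Hf.
    apply: L2norm_le; [exact: sub_L2|exact: sub_L2|by rewrite invr_ge0 ltW|].
    have f0 := preh_ge0 P0 Hf; have Bf0 := preh_ge0 P0 HBf.
    have := coer _ HBf; set x := cdot mu (B f) (B f) in Bf0 *.
    rewrite (cdot_ae (sub_L2 HBf) (sub_L2 (L0Ar HBf)) (sub_L2 Hf) (ArB _ Hf)).
    move=> h; rewrite exprVn ler_pdivlMl ?exprn_gt0//.
    have [->|xn0] := eqVneq x 0; first by rewrite mulr0.
    have x_gt0 : 0 < x by rewrite lt_def xn0.
    have ax0 : 0 <= a * x by rewrite mulr_ge0// ltW.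
    rewrite -(ler_pM2r x_gt0) -mulrA -expr2 -exprMn [leRHS]mulrC.
    apply: le_trans (form_cauchy_schwarz P0 HBf Hf).
    by rewrite ler_sqr// nnegrE (le_trans ax0).
- by move=> f Hf; apply: inj2 => //; [exact/L0B/L0Ar|exact/ArB/L0Ar].
- by move=> f Hf; exact: ArB.
Qed.

(** A bounded inverse makes [A - r] bounded below; as its form is nonnegative,
    bounded_below_coercive applies. *)
Lemma resolvent_coercive :
  (forall f, L2_0 mu f -> r * cdot mu f f <= cdot mu f (A f)) ->
  ~ spectrum mu (L2_0 mu) A (r%:C)%C ->
  exists2 a, 0 < a &
    forall f, L2_0 mu f -> (r + a) * cdot mu f f <= cdot mu f (A f).
Proof.
move=> posA /contrapT [B [boB BA _]].
have [M ArM] := boundAr; have [K BK] := operator_bound sub_L2 boB.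
have K0 : 0 < (`|K| + 1) ^+ 2 by rewrite exprn_gt0// ltr_pwDr.
have low f : L2_0 mu f ->
    ((`|K| + 1) ^+ 2)^-1 * cdot mu f f <= cdot mu (Ar f) (Ar f).
  move=> Hf; have HAf := L0Ar Hf; have [L0B _ _] := boB.
  rewrite ler_pdivrMl// -(cdot_ae_eq (sub_L2 (L0B _ HAf)) (sub_L2 Hf) (BA _ Hf)).
  apply: le_trans (BK _ HAf) _; rewrite ler_wpM2r ?(preh_ge0 P0)//.
  by rewrite -real_normK ?num_real// ler_sqr ?nnegrE ?addr_ge0// lerDl.
have [||a a0 aP] := bounded_below_coercive P0 L0Ar linAr symAr ArM _ _ low.
- by move=> f Hf; rewrite cdot_Ar// subr_ge0 posA.
- by rewrite invr_gt0.
exists a => // f Hf; have := aP _ Hf.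
by rewrite cdot_Ar// lerBrDl -mulrDl.
Qed.

End Operator.

Section RayleighQuotient.
Variable A : (T -> R[i]) -> T -> R[i].
Hypothesis boA : bounded_operator mu (L2_0 mu) A.
Hypothesis symA : forall f g, L2_0 mu f -> L2_0 mu g ->
  cdot mu f (A g) = cdot mu (A f) g.
Hypothesis nontrivial : exists2 f, L2_0 mu f & ~ (f = cst 0 %[ae mu]).

Let quotients :=
  [set cdot mu f (A f) / cdot mu f f | f in [set f | L2_0 mu f /\ cdot mu f f != 0]].

Let has_inf_quotients : has_inf quotients.
Proof.
split.
  have [f Hf fn0] := nontrivial; exists (cdot mu f (A f) / cdot mu f f), f => //.
  by split=> //; apply/eqP => /(cdot_null (sub_L2 Hf)).
have [M AM] := operator_bound sub_L2 boA.
exists (- `|M|) => _ [f [Hf fn0] <-].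
have f_gt0 : 0 < cdot mu f f by rewrite lt_def fn0 (preh_ge0 P0).
have L0A : L2_0 mu (A f) by case: boA => + _ _; exact.
rewrite ler_pdivlMr// mulNr lerNl; apply: le_trans (ler_norm _) _.
have f0 := ltW f_gt0.
rewrite normrN -ler_sqr ?nnegrE ?mulr_ge0// real_normK ?num_real//.
apply: le_trans (form_cauchy_schwarz P0 Hf L0A) _.
rewrite exprMn real_normK ?num_real// mulrC [_ ^+ 2 in leRHS]expr2 mulrA.
by rewrite ler_wpM2r ?AM.
Qed.

(** The infimum of the Rayleigh quotient is a spectral value: otherwise the
    quotient would stay above it by a positive amount. *)
Lemma spectrum_nonempty : exists r : R, spectrum mu (L2_0 mu) A (r%:C)%C.
Proof.
exists (inf quotients); apply: contrapT => nspec.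
have quotP (s : R) f : L2_0 mu f ->
    (cdot mu f f != 0 -> s <= cdot mu f (A f) / cdot mu f f) ->
    s * cdot mu f f <= cdot mu f (A f).
  move=> Hf; have [f0 _|fn0 /(_ isT)] := eqVneq (cdot mu f f) 0.
    have L0A : L2_0 mu (A f) by case: boA => + _ _; exact.
    by rewrite (form_null P0 Hf L0A f0) f0 mulr0.
  by rewrite ler_pdivlMr// lt_def fn0 (preh_ge0 P0).
have [|a a0 aP] := resolvent_coercive boA symA _ nspec.
  move=> f Hf; apply: quotP => // fn0; apply: ge_inf; first exact: has_inf_quotients.2.
  by exists f.
have : inf quotients + a <= inf quotients.
  apply: lb_le_inf; first exact: has_inf_quotients.1.
  move=> _ [f [Hf fn0] <-].
  by rewrite ler_pdivlMr ?aP// lt_def fn0 (preh_ge0 P0).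
by rewrite gerDl leNgt a0.
Qed.

Lemma inf_spectrum_ge (a : R) :
  (forall f, L2_0 mu f -> a * cdot mu f f <= cdot mu f (A f)) ->
  a <= inf [set r : R | spectrum mu (L2_0 mu) A (r%:C)%C].
Proof.
move=> aP; apply: lb_le_inf; first exact: spectrum_nonempty.
move=> r; rewrite leNgt => spec; apply/negP => ra.
apply: (@coercive_notin_spectrum A boA symA r (a - r)) spec.
  by rewrite subr_gt0.
by move=> f Hf; rewrite addrC subrK aP.
Qed.

End RayleighQuotient.

Section SpectralGap.
Variable A : (T -> R[i]) -> T -> R[i].
Hypothesis boA : bounded_operator mu (L2 mu) A.
Hypothesis saA : self_adjoint mu A.
Hypothesis L0A : forall f, L2_0 mu f -> L2_0 mu (A f).

Let oppA f x := - A f x.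

Let oppAE f : oppA f = (- 1) *: (A f : T -> Rcomplex R) + (fun=> 0).
Proof.
by rewrite scale_real; apply/funext => x; rewrite rmorphN1 mulN1r addr0.
Qed.

Let L2_0_cst0 : L2_0 mu (cst 0).
Proof.
have H0 := L2_cst mu (0 : R[i]).
by split => //; rewrite -inner_cst1 inner0r//; exact: L2_cst.
Qed.

Let L0oppA f : L2_0 mu f -> L2_0 mu (oppA f).
Proof. by move=> /L0A HAf; rewrite oppAE; exact: (preh_closed P0). Qed.

Let cdot_oppA f g : L2_0 mu f -> L2_0 mu g ->
  cdot mu f (oppA g) = - cdot mu f (A g).
Proof.
move=> Hf /L0A HAg; rewrite oppAE (preh_linear P0)// -[fun=> 0]/(0 : T -> Rcomplex R).
by rewrite (form0r P0)// addr0 mulN1r.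
Qed.

Let boundedN : bounded_operator mu (L2_0 mu) oppA.
Proof.
have [_ linA [M AM]] := boA; split; first exact: L0oppA.
- move=> c f g /sub_L2 Hf /sub_L2 Hg; apply: filterS (linA c _ _ Hf Hg) => x.
  by move=> /[apply] E; rewrite /oppA E; ring.
- exists M => f Hf; suff -> : L2norm mu (oppA f) = L2norm mu (A f) by exact/AM/sub_L2.
  have HN := L0oppA Hf; have HA := L0A Hf.
  rewrite !L2normE; [|exact: sub_L2..]; congr Num.sqrt.
  by rewrite cdot_oppA// (preh_sym P0 HN HA) oppAE (preh_linear P0)//
    -[fun=> 0]/(0 : T -> Rcomplex R) (form0r P0)// addr0 mulN1r opprK.
Qed.

Let symN f g : L2_0 mu f -> L2_0 mu g -> cdot mu f (oppA g) = cdot mu (oppA f) g.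
Proof.
move=> Hf Hg; rewrite (preh_sym P0 (L0oppA Hf) Hg) (cdot_oppA Hf Hg) (cdot_oppA Hg Hf).
have HAf := L0A Hf; have HAg := L0A Hg; congr (- _).
rewrite (preh_sym P0 Hg HAf) -!Re_inner; try exact: sub_L2.
by rewrite (saA (sub_L2 Hf) (sub_L2 Hg)).
Qed.

Lemma spectral_gap_ge (a : R) :
  (exists2 f, L2_0 mu f & ~ (f = cst 0 %[ae mu])) ->
  (forall f, L2_0 mu f -> a * cdot mu f f <= - cdot mu f (A f)) ->
  a <= spectral_gap mu A.
Proof.
move=> nontriv aP; apply: (inf_spectrum_ge boundedN symN nontriv) => f Hf.
by rewrite cdot_oppA// aP.
Qed.

End SpectralGap.
End Spectrum.

(** * The generator on complex functions *)

Section Generator.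
Context {d : measure_display} {S : measurableType d} {R : realType}.
Variables (q : R.-ker S ~> S) (mu : probability S R) (Q : R).
Implicit Types (f g : S -> R[i]) (c : R[i]).
Hypothesis q_fin : forall x, fin_num_fun (q x).
Hypothesis q_le : {ae mu, forall x, (q x [set: S] <= Q%:E)%E}.
Hypothesis mu_inv : invariant_measure q mu.

Let L : (S -> R[i]) -> S -> R[i] := jump_generator q.
Let re f x := complex.Re (f x).
Let im f x := complex.Im (f x).

Lemma Re_jump_generator f : (fun x => complex.Re (L f x)) = real_generator q (re f).
Proof.
by apply/funext => x; apply: eq_Rintegral => y _; rewrite Re_sub.
Qed.

Lemma Im_jump_generator f : (fun x => complex.Im (L f x)) = real_generator q (im f).
Proof.
by apply/funext => x; apply: eq_Rintegral => y _; rewrite Im_sub.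
Qed.

Lemma Rintegral_real_generator_bounded (h : S -> R) :
  measurable_fun [set: S] h -> (exists M, forall x, `|h x| <= M) ->
  \int[mu]_x real_generator q h x = 0.
Proof.
move=> mh [M hM]; have mhC : cmeasurable (fun x => Complex (h x) 0) by split.
have := mu_inv mhC; rewrite -/L => h0.
have /h0/(congr1 (@complex.Re R)) :
    exists M, forall x, Normc.normc (Complex (h x) 0) <= M.
  by exists M => x; rewrite /= expr0n/= addr0 sqrtr_sqr.
rewrite -[complex.Re (cintegral _ _)]/(\int[mu]_x complex.Re (L _ x)).
by rewrite Re_jump_generator.
Qed.

Let inv := Rintegral_real_generator_bounded.

Let Q_ge0 : 0 <= Q.
Proof.
have mu0 : (0 < mu [set: S])%E by rewrite [X in (0 < X)%E](probability_setT mu).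
have PF := ae_properfilter_algebraOfSetsType mu0.
have [x /andP[r0 rQ]] := filter_ex (ae_rate_le q_fin q_le).
exact: le_trans r0 rQ.
Qed.

Lemma jump_generator_L2 f : L2 mu f ->
  [/\ L2 mu (L f),
      cdot mu (L f) (L f) <= (2 * Q) ^+ 2 * cdot mu f f
    & cdot mu (L f) (L f) <= - (2 * Q) * cdot mu f (L f)].
Proof.
move=> /L2P[Hr Hi].
have [Lr br dr] := sqint_real_generator q_fin q_le inv Hr.
have [Li bi di] := sqint_real_generator q_fin q_le inv Hi.
rewrite -(Re_jump_generator f) in Lr br dr; rewrite -(Im_jump_generator f) in Li bi di.
split; first exact/L2P.
- by have := lerD br bi; rewrite -mulrDr.
- by have := lerD dr di; rewrite -mulrDr.
Qed.

Lemma jump_generator_linear c f g : L2 mu f -> L2 mu g ->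
  L (fun x => c * f x + g x) = (fun x => c * L f x + L g x) %[ae mu].
Proof.
move=> /L2_cintegrable[fr fi] /L2_cintegrable[gr gi].
have lin := real_generator_linear q_fin q_le inv.
pose a := complex.Re c; pose b := complex.Im c.
have ir := RintegrableD (RintegrableZ (- b) fi) gr.
have ii := RintegrableD (RintegrableZ b fr) gi.
have reE : re (fun x => c * f x + g x) = fun x => a * re f x + (- b * im f x + re g x).
  by apply/funext => x; rewrite /re Re_add Re_mul /im /a /b; ring.
have imE : im (fun x => c * f x + g x) = fun x => a * im f x + (b * re f x + im g x).
  by apply/funext => x; rewrite /im Im_add Im_mul /re /a /b; ring.
apply: filterS2 (filterI (lin a _ _ fr ir) (lin (- b) _ _ fi gr))
  (filterI (lin a _ _ fi ii) (lin b _ _ fr gi)) => x.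
move=> [/(_ I) E1 /(_ I) E2] [/(_ I) E3 /(_ I) E4] _.
have reL k : complex.Re (L k x) = real_generator q (re k) x.
  by rewrite -Re_jump_generator.
have imL k : complex.Im (L k x) = real_generator q (im k) x.
  by rewrite -Im_jump_generator.
apply: eq_Complex.
- by rewrite Re_add Re_mul !reL !imL reE E1 E2 -/a -/b; ring.
- by rewrite Im_add Im_mul !reL !imL imE E3 E4 -/a -/b; ring.
Qed.

Lemma jump_generator_bounded : bounded_operator mu (L2 mu) L.
Proof.
split; first by move=> f /jump_generator_L2[].
- by move=> c f g; exact: jump_generator_linear.
- exists (2 * Q) => f Hf; have [HL b _] := jump_generator_L2 Hf.
  by apply: L2norm_le => //; rewrite mulr_ge0.
Qed.

Lemma cintegral_jump_generator f : L2 mu f -> cintegral mu (L f) = 0.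
Proof.
move=> /L2_cintegrable[fr fi]; apply: eq_Complex.
- rewrite -[LHS]/(\int[mu]_x complex.Re (L f x)) Re_jump_generator.
  by rewrite (Rintegral_real_generator q_fin q_le inv).
- rewrite -[LHS]/(\int[mu]_x complex.Im (L f x)) Im_jump_generator.
  by rewrite (Rintegral_real_generator q_fin q_le inv).
Qed.

Lemma jump_generator_cst c : L (cst c) = cst 0.
Proof.
apply/funext => x; rewrite /L /jump_generator /cintegral.
by apply: eq_Complex => /=; under eq_Rintegral do rewrite subrr;
  rewrite Rintegral_cst ?mul0r.
Qed.

Let Ls := symmetrized mu L.
Let boL := jump_generator_bounded.
Let L0L2 : L2_0 mu `<=` L2 mu. Proof. by move=> f []. Qed.

(** Invariance says that [L f] has mean zero, and [L 1 = 0] says the same of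
    [L^* f]. *)
Lemma L2_0_symmetrized_generator f : L2 mu f -> L2_0 mu (Ls f).
Proof.
move=> Hf; have H1 := L2_cst mu (1 : R[i]).
split; first exact: L2_symmetrized.
rewrite -inner_cst1 inner_symmetrized// inner_cst1 cintegral_jump_generator//.
by rewrite jump_generator_cst inner_conj ?inner0r ?conjc0 ?addr0 ?mulr0//; exact: L2_cst.
Qed.

Lemma cdot_symmetrized_generator f : L2 mu f -> cdot mu f (Ls f) = cdot mu f (L f).
Proof.
move=> Hf; have [HL _ _] := jump_generator_L2 Hf.
rewrite -!Re_inner//; last exact: L2_symmetrized.
rewrite inner_symmetrized// [inner mu (L f) f]inner_conj//.
rewrite (_ : 2^-1 = (2^-1%:C)%C); last by rewrite rmorphV/= ?rmorph_nat ?unitfE.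
by rewrite Re_mul Re_real Im_real mul0r subr0 Re_add Re_conjc; field.
Qed.

Lemma singular_value_gap_le_sqrt :
  singular_value_gap mu L <= Num.sqrt (2 * Q * spectral_gap mu Ls).
Proof.
rewrite /singular_value_gap; set E := [set _ | _ in _]; set gamma := inf E.
(* if there is no nonzero mean-zero function, [gamma] is the infimum of the
   empty set, which is 0 *)
have [nontriv|triv] := pselect (exists2 f, L2_0 mu f & ~ (f = cst 0 %[ae mu])); last first.
  rewrite /gamma (_ : E = set0) ?inf0 ?sqrtr_ge0//.
  by rewrite -subset0 => t [f [Hf fn0] _]; apply: triv; exists f.
have E0 : E !=set0.
  by have [f Hf fn0] := nontriv; exists (L2norm mu (L f) / L2norm mu f), f.
have Elb : lbound E 0.
  by move=> _ [f [/L0L2 Hf _] <-]; have [HL _ _] := jump_generator_L2 Hf;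
    rewrite divr_ge0// L2normE// sqrtr_ge0.
have gamma_ge0 : 0 <= gamma by exact: lb_le_inf.
have P := L2_prehilbert mu.
have dissip f : L2_0 mu f ->
    gamma ^+ 2 * cdot mu f f <= 2 * Q * - cdot mu f (Ls f).
  move=> /[dup] /L0L2 Hf H0f; have [HL _ LfL] := jump_generator_L2 Hf.
  rewrite cdot_symmetrized_generator// mulrN -mulNr.
  apply: le_trans LfL.
  have f0 := preh_ge0 P Hf; have Lf0 := preh_ge0 P HL.
  have [->|fn0] := eqVneq (cdot mu f f) 0; first by rewrite mulr0.
  have f_gt0 : 0 < cdot mu f f by rewrite lt_def fn0.
  have : gamma <= L2norm mu (L f) / L2norm mu f.
    apply: ge_inf; first by exists 0.
    exists f => //; split=> // fae0; move/eqP: fn0; apply.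
    rewrite (cdot_ae_eq Hf (L2_cst mu 0) fae0).
    rewrite -[cst 0]/(0 : S -> Rcomplex R) (form0r P)//; exact: L2_cst.
  rewrite !L2normE// ler_pdivlMr ?sqrtr_gt0// => h.
  rewrite -[leRHS]sqr_sqrtr// -[cdot mu f f]sqr_sqrtr// -exprMn.
  by rewrite ler_sqr// nnegrE ?mulr_ge0// sqrtr_ge0.
have key : gamma ^+ 2 <= 2 * Q * spectral_gap mu Ls.
  (* for [Q = 0] the division below is impossible, but then [gamma = 0] *)
  have [Q0|Qn0] := eqVneq Q 0.
    have [f Hf fn0] := nontriv; have := dissip _ Hf.
    rewrite Q0 mulr0 !mul0r pmulr_lle0// lt_def (preh_ge0 P) ?andbT; last exact: L0L2.
    by apply/eqP => /(cdot_null (L0L2 Hf)).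
  have Q_gt0 : 0 < 2 * Q by rewrite mulr_gt0// lt_def Qn0.
  rewrite -ler_pdivrMl//; apply: spectral_gap_ge => //.
  - exact: symmetrized_bounded.
  - exact: symmetrized_self_adjoint.
  - by move=> f [Hf _]; exact: L2_0_symmetrized_generator.
  - by move=> f Hf; rewrite -mulrA ler_pdivrMl// dissip.
rewrite -[leLHS]ger0_norm// -sqrtr_sqr; exact: ler_wsqrtr.
Qed.

End Generator.

Theorem proposition4 (R : realType) (d : measure_display)
    (S : measurableType d) (q : R.-ker S ~> S) (mu : probability S R)
    (q_max : R) :
  (forall x : S, fin_num_fun (q x)) ->
  invariant_measure q mu ->
  {ae mu, forall x : S, (q x [set: S] <= q_max%:E)%E} ->
  let L := jump_generator q in
  let Ls := symmetrized mu L in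
  [/\ bounded_operator mu (L2 mu) Ls,
      self_adjoint mu Ls
    & singular_value_gap mu L <= Num.sqrt (2%:R * q_max * spectral_gap mu Ls)].
Proof.
move=> q_fin mu_inv q_le L Ls.
have boL := jump_generator_bounded q_fin q_le mu_inv.
split; [exact: symmetrized_bounded|exact: symmetrized_self_adjoint|].
exact: singular_value_gap_le_sqrt.
Qed.
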